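(* Let $V$ be a simple, corational graded vertex operator coalgebra with $\rho\in V_2^*$, let $\mathcal C$ be the category of admissible $V$-comodules, and assume every object of $\mathcal C$ has finite-dimensional homogeneous subspaces and all fusion rules of cointertwining operators are finite. Let $V'$ be the dual vertex operator algebra, and regard $\mathcal C^{op}$ as the category of admissible $V'$-modules via $\mathcal M\mapsto\mathcal M'$. Let $\{\mathcal M^i\}_{i\in I}$ be a complete set of simple admissible $V$-comodules, let $\mathbb K[\mathcal C]=\mathbb C\otimes_{\mathbb Z}K[\mathcal C]$ and $\mathbb K[\mathcal C^{op}]=\mathbb C\otimes_{\mathbb Z}K[\mathcal C^{op}]$ be the complexified Grothendieck groups, equipped respectively with the coalgebra structure $\Delta_{\Box_V}([\mathcal M^k])=\sum_{i,j\in I}N^{\mathcal M^i,\mathcal M^j}_{\mathcal M^k}[\mathcal M^i]\otimes[\mathcal M^j]$ (counit $\epsilon_V([\mathcal M^k])=1$ if $\mathcal M^k\cong V$ and $0$ otherwise) and with the fusion algebra structure $[(\mathcal M^i)']*[(\mathcal M^j)']=\sum_{s\in I}N^{(\mathcal M^s)'}_{(\mathcal M^i)',(\mathcal M^j)'}[(\mathcal M^s)']$ (unit $[V']$). Then, with respect to the pairing between $\mathbb K[\mathcal C^{op}]$ and $\mathbb K[\mathcal C]$ for which $\{[(\mathcal M^i)']\}_{i\in I}$ is the dual basis of $\{[\mathcal M^i]\}_{i\in I}$: (i) $\mathbb K[\mathcal C^{op}]$ is the dual algebra of $\mathbb K[\mathcal C]$; (ii) $\mathbb K[\mathcal C]$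 is the dual coalgebra of $\mathbb K[\mathcal C^{op}]$.
   Context: Everything is over $\mathbb C$; $\tau(v\otimes w)=w\otimes v$; $\delta(x)=\sum_{n\in\mathbb Z}x^n$; $(z_1+z_2)^n$ is expanded in nonnegative powers of the second variable; $W\{z\}=\{\sum_{k\in\mathbb C}w_kz^k: w_k\in W\}$; $(\cdot,\cdot)$ is the natural pairing of a space with its dual. A graded vertex operator coalgebra is a tuple $(V,\Upsilon(z),c,\rho)$: a $\mathbb Z$-graded space $V=\bigoplus_s V_s$ with $\dim V_s<\infty$, $V_s=0$ for $s\ll0$; linear maps $c,\rho:V\to\mathbb C$; a linear map $\Upsilon(z):V\to (V\otimes V)[[z,z^{-1}]]$, $v\mapsto\sum_{k\in\mathbb Z}\Delta_k(v)z^{-k-1}$, such that: (i) each $\Delta_k(v)\in V\otimes V$ and $\Delta_k(v)=0$ for $k\ll0$; $\Delta_k(V_s)\subset (V\otimes V)_{s+k+1}$; (ii) $(c\otimes\mathrm{Id})\Upsilon(z)v=v$, $(\mathrm{Id}\otimes c)\Upsilon(z)v\in V[[z]]$, with limit $v$ as $z\to0$; (iii) Jacobi identity $$z_0^{-1}\delta\big(\tfrac{z_1-z_2}{z_0}\big)(\mathrm{Id}\otimes\Upsilon(z_2))\Upsilon(z_1)-z_0^{-1}\delta\big(\tfrac{z_2-z_1}{-z_0}\big)(\tau\otimes\mathrm{Id})(\mathrm{Id}\otimes\Upsilon(z_1))\Upsilon(z_2)=z_1^{-1}\delta\big(\tfrac{z_2+z_0}{z_1}\big)(\Upsilon(z_0)\otimes\mathrm{Id})\Upsilon(z_2);$$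 (iv) writing $(\rho\otimes\mathrm{Id})\Upsilon(z)=\sum_kL_V(k)z^{k-2}$ with $L_V(k)\in\mathrm{End}(V)$, one has $[L_V(k),L_V(j)]=(k-j)L_V(k+j)+\frac{k^3-k}{12}\delta_{k+j,0}d$ for a constant $d\in\mathbb C$ (the rank); $V_s$ is the eigenspace of $L_V(0)$ with eigenvalue $s$; and $(L_V(1)\otimes\mathrm{Id})\Upsilon(z)=\frac{d}{dz}\Upsilon(z)=\Upsilon(z)L_V(1)-(\mathrm{Id}\otimes L_V(1))\Upsilon(z)$. An admissible $V$-comodule $(\mathcal M,\Upsilon_{\mathcal M}(z))$ is an $\mathbb N$-graded space $\mathcal M=\bigoplus_{t\in\mathbb N}M(t)$ with a linear map $\Upsilon_{\mathcal M}(z):\mathcal M\to (V\otimes\mathcal M)[[z,z^{-1}]]$, $\Upsilon_{\mathcal M}(z)=\sum_k\Delta_{\mathcal M,k}z^{-k-1}$, such that: each $\Delta_{\mathcal M,k}(m)\in V\otimes \mathcal M$ is a finite sum and vanishes for $k\ll0$; $(c\otimes\mathrm{Id})\Upsilon_{\mathcal M}(z)m=m$; the Jacobi identity $$z_0^{-1}\delta\big(\tfrac{z_1-z_2}{z_0}\big)(\mathrm{Id}\otimes\Upsilon_{\mathcal M}(z_2))\Upsilon_{\mathcal M}(z_1)-z_0^{-1}\delta\big(\tfrac{z_2-z_1}{-z_0}\big)(\tau\otimes\mathrm{Id})(\mathrm{Id}\otimes\Upsilon_{\mathcal M}(z_1))\Upsilon_{\mathcal M}(z_2)=z_1^{-1}\delta\big(\tfrac{z_2+z_0}{z_1}\big)(\Upsilon(z_0)\otimes\mathrm{Id})\Upsilon_{\mathcal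 M}(z_2);$$ writing $(\rho\otimes\mathrm{Id})\Upsilon_{\mathcal M}(z)=\sum_kL_V(k)z^{k-2}$ with $L_V(k)\in\mathrm{End}(\mathcal M)$, the same Virasoro relations hold on $\mathcal M$; $(L_V(1)\otimes\mathrm{Id})\Upsilon_{\mathcal M}(z)=\frac{d}{dz}\Upsilon_{\mathcal M}(z)=\Upsilon_{\mathcal M}(z)L_V(1)-(\mathrm{Id}\otimes L_V(1))\Upsilon_{\mathcal M}(z)$; and $\Delta_{\mathcal M,k}(M(t))\subset\bigoplus_{s\in\mathbb N}V_{t+k+1-s}\otimes M(s)$. $\mathcal M$ is simple if it has no nontrivial admissible subcomodule, cosemisimple if it is a direct sum of simple admissible subcomodules. $V$ is simple if it is simple as a comodule over itself, and corational if every admissible $V$-comodule is cosemisimple. For $V$ simple and corational, $\mathcal C$ is semisimple with finitely many isomorphism classes of simple objects (known), and the $[\mathcal M^i]$ form a basis of $\mathbb K[\mathcal C]$. A cointertwining operator of type $\binom{\mathcal M^1\ \mathcal M^2}{\mathcal M^3}$ is a linear map $\mathcal W(z):\mathcal M^3\to(\mathcal M^1\otimes\mathcal M^2)\{z\}$, $m^3\mapsto\sum_{t\in\mathbb C}\Delta_t(m^3)z^{-t-1}$, $\Delta_t(m^3)\in\mathcal M^1\otimes\mathcal M^2$, such that $\Delta_t(m^3)=0$ when the real part of $t$ is sufficiently small; $\frac{d}{dz}\mathcal W(z)=(L_V(1)\otimes\mathrm{Id})\mathcal W(z)$; and $$z_0^{-1}\delta\big(\tfrac{z_1-z_2}{z_0}\big)(\mathrm{Id}\otimes\mathcal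 W(z_2))\Upsilon_{\mathcal M^3}(z_1)-z_0^{-1}\delta\big(\tfrac{z_2-z_1}{-z_0}\big)(\tau\otimes\mathrm{Id})(\mathrm{Id}\otimes\Upsilon_{\mathcal M^2}(z_1))\mathcal W(z_2)=z_1^{-1}\delta\big(\tfrac{z_2+z_0}{z_1}\big)(\Upsilon_{\mathcal M^1}(z_0)\otimes\mathrm{Id})\mathcal W(z_2).$$ They form a vector space of dimension $N^{\mathcal M^1,\mathcal M^2}_{\mathcal M^3}$. Duals (known): $V'=\bigoplus_sV_s^*$ is a vertex operator algebra with vacuum $c$, conformal vector $\rho$ and $(Y(f,z)g,v)=(f\otimes g,\Upsilon(z)v)$ for $f,g\in V'$, $v\in V$; for $V$ simple and corational it is simple and rational (every admissible $V'$-module is completely reducible). If $\mathcal M=\bigoplus_s M(s)$ is an admissible $V$-comodule, $\mathcal M'=\bigoplus_sM(s)^*$ is an admissible $V'$-module via $(Y_{\mathcal M'}(f,z)m^*,m)=(f\otimes m^*,\Upsilon_{\mathcal M}(z)m)$. For $V'$-modules, $N^{\mathcal N_3}_{\mathcal N_1,\mathcal N_2}$ is the dimension of the space of (standard) intertwining operators of type $\binom{\mathcal N_3}{\mathcal N_1\ \mathcal N_2}$; the fusion algebra $\mathbb K[\mathcal C^{op}]$ is a known finite-dimensional commutative associative algebra. Dual algebra of a coalgebra $(C,\Delta,\epsilon)$: $C^*$ with $(f g)(a)=(f\otimes g)(\Delta(a))$ and unit $\epsilon$. Dual coalgebra of a finite-dimensional algebra $A$: $A^*$ with $(\Delta(f),a\otimes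 b)=f(ab)$ and counit $f\mapsto f(1)$. *)

(* Defs.v *)
(* The complex numbers are R[i], for an arbitrary R : realType. *)
From HB Require Import structures.
From mathcomp Require Import all_boot all_order all_algebra.
From mathcomp Require Import sesquilinear complex.
From mathcomp Require Import boolp classical_sets functions cardinality fsbigop.
From mathcomp Require Import reals.

Set Implicit Arguments.
Unset Strict Implicit.
Unset Printing Implicit Defensive.

Import GRing.Theory.
Local Open Scope classical_set_scope.
Local Open Scope ring_scope.

(* Tensor products over a field F.  A tensor is a finite sequence of pairs    *)
(* (v, w), read as the sum of the v ⊗ w; two sequences are identified when    *)
(* every bilinear map takes the same value on both.  This is equality in the  *)
(* tensor product, as the universal bilinear map is among those tested.       *)

Section Tensor.
Variables (F : fieldType) (V W : lmodType F).

Definition tsum (U : lmodType F) (b : V -> W -> U) (s : seq (V * W)) : U :=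
  \sum_(p <- s) b p.1 p.2.

Definition tensor_rel : rel (seq (V * W)) := fun s t =>
  `[< forall (U : lmodType F) (b : V -> W -> U),
        bilinear_for *:%R *:%R b -> tsum b s = tsum b t >].

Lemma tensor_rel_refl : reflexive tensor_rel.
Proof. by move=> s; apply/asboolP. Qed.

Lemma tensor_rel_sym : symmetric tensor_rel.
Proof.
by move=> s t; apply/asboolP/asboolP => H U b Hb; rewrite (H U b Hb).
Qed.

Lemma tensor_rel_trans : transitive tensor_rel.
Proof.
move=> t s r /asboolP H1 /asboolP H2; apply/asboolP => U b Hb.
by rewrite (H1 U b Hb) (H2 U b Hb).
Qed.

Canonical tensor_equiv :=
  EquivRel tensor_rel tensor_rel_refl tensor_rel_sym tensor_rel_trans.

Definition tensor := {eq_quot tensor_equiv}%qT.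

HB.instance Definition _ := Choice.on tensor.

Definition mktensor (s : seq (V * W)) : tensor := (\pi_tensor s)%qT.
Definition rtensor (x : tensor) : seq (V * W) := repr x.

Lemma rtensorK : cancel rtensor mktensor.
Proof. exact: reprK. Qed.

Lemma mktensorP s t : mktensor s = mktensor t <->
  forall (U : lmodType F) (b : V -> W -> U),
    bilinear_for *:%R *:%R b -> tsum b s = tsum b t.
Proof.
split=> [/eqmodP /= /asboolP //|H].
by apply/eqmodP => /=; apply/asboolP.
Qed.

Definition tens (v : V) (w : W) : tensor := mktensor [:: (v, w)].

Definition tlift (U : lmodType F) (b : V -> W -> U) (x : tensor) : U :=
  tsum b (rtensor x).

Lemma tlift_mk (U : lmodType F) (b : V -> W -> U) s :
  bilinear_for *:%R *:%R b -> tlift b (mktensor s) = tsum b s.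
Proof.
by move=> Hb; have /mktensorP := rtensorK (mktensor s); apply.
Qed.

Lemma tensor_eqP (x y : tensor) :
  (forall (U : lmodType F) (b : V -> W -> U),
     bilinear_for *:%R *:%R b -> tlift b x = tlift b y) -> x = y.
Proof.
move=> H; rewrite -[x]rtensorK -[y]rtensorK; apply/mktensorP => U b Hb.
exact: H.
Qed.

Definition tzero : tensor := mktensor [::].
Definition tadd (x y : tensor) := mktensor (rtensor x ++ rtensor y).
Definition tscale (a : F) (x : tensor) :=
  mktensor [seq (a *: p.1, p.2) | p <- rtensor x].
Definition topp (x : tensor) := tscale (-1) x.

Section Lift.
Variables (U : lmodType F) (b : V -> W -> U) (Hb : bilinear_for *:%R *:%R b).

Lemma tlift0 : tlift b tzero = 0.
Proof. by rewrite tlift_mk // /tsum big_nil. Qed.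

Lemma tliftD x y : tlift b (tadd x y) = tlift b x + tlift b y.
Proof. by rewrite tlift_mk // /tsum big_cat. Qed.

Lemma tliftZ a x : tlift b (tscale a x) = a *: tlift b x.
Proof.
have Hz w : b 0 w = 0.
  have := Hb.1 w (-1) 0 0; rewrite /= !scaleN1r oppr0 addr0 => ->.
  by rewrite addNr.
rewrite tlift_mk // /tsum big_map /tlift /tsum scaler_sumr.
apply: eq_bigr => p _ /=; have := Hb.1 p.2 a p.1 0.
by rewrite !addr0 Hz addr0.
Qed.

Lemma tliftN x : tlift b (topp x) = - tlift b x.
Proof. by rewrite tliftZ scaleN1r. Qed.

Lemma tlift_tens v w : tlift b (tens v w) = b v w.
Proof. by rewrite tlift_mk // /tsum big_seq1. Qed.

End Lift.

Lemma taddA : associative tadd.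
Proof.
by move=> x y z; apply: tensor_eqP => U b Hb; rewrite !tliftD // addrA.
Qed.
Lemma taddC : commutative tadd.
Proof.
by move=> x y; apply: tensor_eqP => U b Hb; rewrite !tliftD // addrC.
Qed.
Lemma tadd0 : left_id tzero tadd.
Proof.
by move=> x; apply: tensor_eqP => U b Hb; rewrite tliftD // tlift0 // add0r.
Qed.
Lemma taddN : left_inverse tzero topp tadd.
Proof.
move=> x; apply: tensor_eqP => U b Hb.
by rewrite tliftD // tliftN // tlift0 // addNr.
Qed.

HB.instance Definition _ :=
  GRing.isZmodule.Build tensor taddA taddC tadd0 taddN.

Lemma tscaleA a b x : tscale a (tscale b x) = tscale (a * b) x.
Proof. by apply: tensor_eqP => U f Hf; rewrite !tliftZ // scalerA. Qed.
Lemma tscale1 : left_id 1 tscale.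
Proof. by move=> x; apply: tensor_eqP => U f Hf; rewrite tliftZ // scale1r. Qed.
Lemma tscaleDr : right_distributive tscale +%R.
Proof.
move=> a x y; apply: tensor_eqP => U f Hf.
by rewrite tliftD // !tliftZ // tliftD // scalerDr.
Qed.
Lemma tscaleDl x : {morph tscale^~ x : a b / a + b}.
Proof.
move=> a b; apply: tensor_eqP => U f Hf.
by rewrite tliftD // !tliftZ // scalerDl.
Qed.

HB.instance Definition _ :=
  GRing.Zmodule_isLmodule.Build F tensor tscaleA tscale1 tscaleDr tscaleDl.

Lemma tlift_linear (U : lmodType F) (b : V -> W -> U) :
  bilinear_for *:%R *:%R b -> linear (tlift b).
Proof. by move=> Hb a x y; rewrite tliftD // tliftZ. Qed.

Lemma tens_bilinear : bilinear_for *:%R *:%R tens.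
Proof.
split=> [w|v] a x y; apply: tensor_eqP => U b Hb;
  rewrite (tlift_linear Hb) !tlift_tens //.
- exact: Hb.1.
- exact: Hb.2.
Qed.

End Tensor.

Notation "v ⊗ w" := (tens v w) (at level 40, left associativity).

Section TensorMaps.
Variable F : fieldType.

(* f ⊗ g *)
Definition tmap (V W V' W' : lmodType F) (f : V -> V') (g : W -> W') :
  tensor V W -> tensor V' W' := tlift (fun v w => f v ⊗ g w).

(* f ⊗ g for linear functionals f and g, with values in F ⊗ F = F *)
Definition tform (V W : lmodType F) (f : V -> F) (g : W -> F) :
  tensor V W -> F := tlift (fun v w => f v * g w : F^o).

(* f ⊗ Id and Id ⊗ g with values in F ⊗ W = W and V ⊗ F = V *)
Definition tforml (V W : lmodType F) (f : V -> F) : tensor V W -> W :=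
  tlift (fun v w => f v *: w).
Definition tformr (V W : lmodType F) (g : W -> F) : tensor V W -> V :=
  tlift (fun v w => g w *: v).

(* (u ⊗ v) ⊗ w |-> u ⊗ (v ⊗ w) *)
Definition tassoc (U V W : lmodType F) :
  tensor (tensor U V) W -> tensor U (tensor V W) :=
  tlift (fun x w => tlift (fun u v => u ⊗ (v ⊗ w)) x).

(* τ ⊗ Id, read on right-associated products: u ⊗ (v ⊗ w) |-> v ⊗ (u ⊗ w) *)
Definition tswap (U V W : lmodType F) :
  tensor U (tensor V W) -> tensor V (tensor U W) :=
  tlift (fun u y => tlift (fun v w => v ⊗ (u ⊗ w)) y).

End TensorMaps.

Section LinearAlgebra.
Variables (F : fieldType) (V : lmodType F).

Definition subspace (S : set V) : Prop :=
  S 0 /\ forall (a : F) x y, S x -> S y -> S (a *: x + y).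

Definition span (S : set V) : set V := [set x |
  exists s : seq (F * V),
    (forall p, p \in s -> S p.2) /\ x = \sum_(p <- s) p.1 *: p.2].

Definition fin_dim (S : set V) : Prop :=
  exists s : seq V, S `<=` span [set` s].

Definition has_dim (S : set V) (n : nat) : Prop :=
  exists b : 'I_n -> V,
    (forall i, S (b i)) /\
    (forall x, S x -> exists! a : {ffun 'I_n -> F}, x = \sum_i a i *: b i).

(* 0 when S is infinite-dimensional *)
Definition dim (S : set V) : nat := xget 0%N [set n | has_dim S n].

Definition direct_sum (J : choiceType) (S : J -> set V) : Prop :=
  (forall j, subspace (S j)) /\
  forall x, exists! f : J -> V,
    [/\ forall j, S j (f j), finite_set [set j | f j != 0]
      & x = \sum_(j \in [set: J]) f j].

Definition homogeneous (J : choiceType) (gr : J -> set V) (S : set V) : Prop :=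
  S `<=` span [set x | S x /\ exists j, gr j x].

Definition is_basis (I : finType) (e : I -> V) : Prop :=
  forall x, exists! a : {ffun I -> F}, x = \sum_i a i *: e i.

End LinearAlgebra.

Definition tensor_gr (F : fieldType) (V W : lmodType F) (J : Type)
    (emb : J -> int) (grV : int -> set V) (grW : J -> set W) (n : int) :
    set (tensor V W) :=
  span [set x | exists r s v w,
    [/\ r + emb s = n, grV r v, grW s w & x = v ⊗ w]].

(* Simple and semisimple objects, relative to a notion sub of subobject *)
Section Semisimple.
Variables (F : fieldType) (M : lmodType F) (sub : set M -> Prop).

Definition simple_sub (S : set M) : Prop :=
  [/\ sub S, S <> [set 0]
    & forall T, sub T -> T `<=` S -> T = [set 0] \/ T = S].

Definition semisimple : Prop :=
  exists (J : choiceType) (S : J -> set M),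
    (forall j, simple_sub (S j)) /\ direct_sum S.

Definition fin_semisimple : Prop :=
  exists (n : nat) (S : 'I_n -> set M),
    (forall j, simple_sub (S j)) /\ direct_sum S.

End Semisimple.

(* The graded dual ⊕_j (M_j)^* of M = ⊕_j M_j: the linear functionals on M    *)
(* that vanish on all but finitely many of the M_j.                           *)
Section GradedDual.
Variables (F : fieldType) (M : lmodType F) (J : choiceType) (gr : J -> set M).

Definition gdual_pred : {pred M -> F^o} := fun f =>
  `[< scalar f /\
      exists s : seq J, forall j x, j \notin s -> gr j x -> f x = 0 >].

Lemma gdual_submod : submod_closed gdual_pred.
Proof.
split.
  apply/asboolP; split; first by move=> a x y; rewrite /= mulr0 addr0.
  by exists [::].
move=> a f g /asboolP [lf [s fs]] /asboolP [lg [t gt]]; apply/asboolP; split.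
  move=> k x y; rewrite !addrfctE !scalrfctE /= lf lg /GRing.scale /=.
  by rewrite !mulrDr addrACA; congr (_ + _ + _); rewrite mulrCA.
exists (s ++ t) => j x; rewrite mem_cat negb_or => /andP [js jt] xj.
by rewrite addrfctE scalrfctE /= (fs j) // (gt j) // scaler0 addr0.
Qed.

HB.instance Definition _ :=
  GRing.isSubmodClosed.Build F (M -> F^o) gdual_pred gdual_submod.

Record gdual := GDual { gdual_fun :> M -> F^o; _ : gdual_fun \in gdual_pred }.

HB.instance Definition _ := [isSub for gdual_fun].
HB.instance Definition _ := [Choice of gdual by <:].
HB.instance Definition _ := [SubChoice_isSubLmodule of gdual by <:].

Lemma gdualP (f : gdual) : scalar f /\
  exists s : seq J, forall j x, j \notin s -> gr j x -> f x = 0.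
Proof. by have /asboolP := valP f. Qed.

(* f itself when f lies in the graded dual; only used in that case *)
Definition to_gdual (f : M -> F^o) : gdual := insubd 0 f.

Definition gdual_gr (j : J) : set gdual :=
  [set f : gdual | forall i x, i != j -> gr i x -> f x = 0].

End GradedDual.

Section DualMode.
Variables (F : fieldType) (V M : lmodType F) (grV : int -> set V).
Variables (J : choiceType) (emb : J -> int) (grM : J -> set M).

Lemma tform_linear (f : gdual grV) (g : gdual grM) : scalar (tform f g).
Proof.
have [lf _] := gdualP f; have [lg _] := gdualP g.
apply: (@tlift_linear F V M F^o); split=> [w|v] a x y /=.
  by rewrite lf /GRing.scale /= mulrDl mulrA.
by rewrite lg /GRing.scale /= mulrDr mulrCA.
Qed.

(* The modes of dual_voa and dual_module below never meet the default of
   to_gdual: the functionals defining them are in the graded dual. *)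
Lemma tform_gdual (D : {linear M -> tensor V M}) (k : int)
    (f : gdual grV) (g : gdual grM) : injective emb ->
  (forall t x, grM t x -> tensor_gr emb grV grM (emb t + k + 1) (D x)) ->
  (fun x => tform f g (D x) : F^o) \in gdual_pred grM.
Proof.
move=> emb_inj Dgr; have lfg := tform_linear f g.
have l0 : tform f g 0 = 0.
  by have := lfg (-1) 0 0; rewrite scaler0 addr0 mulN1r addNr.
apply/asboolP; split; first by move=> a x y; rewrite linearP lfg.
have [lf [sf fs]] := gdualP f; have [lg [sg gs]] := gdualP g.
pose P (rs : int * J) (j : J) := emb j + k + 1 == rs.1 + emb rs.2.
exists (pmap (fun rs => if pselect (exists j, P rs j) is left e
    then Some (xchoose e) else None) [seq (r, s) | r <- sf, s <- sg]).
move=> j x jN xj.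
have [s [sP ->]] := Dgr _ _ xj.
elim: s sP => [|p s IH] sP; first by rewrite big_nil l0.
rewrite big_cons lfg IH ?addr0; last first.
  by move=> q qs; apply: sP; rewrite inE qs orbT.
have [r [i [v [w [E vr wi ->]]]]] := sP p (mem_head _ _).
suff -> : tform f g (v ⊗ w) = 0 by rewrite mulr0.
have bfg : bilinear_for *:%R *:%R (fun v w => (f v * g w : F^o)).
  split=> [u|u] a y z /=.
    by rewrite lf /GRing.scale /= mulrDl mulrA.
  by rewrite lg /GRing.scale /= mulrDr mulrCA.
rewrite /tform (tlift_tens bfg).
case: (boolP (r \in sf)) => rsf; last by rewrite (fs r) ?mul0r.
case: (boolP (i \in sg)) => isg; last by rewrite (gs i) ?mulr0.
case/negP: jN; rewrite mem_pmap; apply/mapP; exists (r, i).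
  by apply/allpairsP; exists (r, i).
have e : exists j0, P (r, i) j0 by exists j; rewrite /P /= E.
case: pselect => [e'|//]; congr Some.
have := xchooseP e'; rewrite {1}/P /= E => /eqP /addIr /addIr /emb_inj.
by [].
Qed.

End DualMode.

Section Formal.
Variable C : fieldType.

(* n (n - 1) ... (n - i + 1) / i! *)
Definition binz (n : int) (i : nat) : C :=
  (\prod_(j < i) (n%:~R - j%:R)) / (i`!)%:R.

(* The coefficient of z0^(-l-1) z1^(-m-1) z2^(-t-1) in the Jacobi identity
   for W(z) = Σ_t W_t z^(-t-1) : M3 -> M1 ⊗ M2, where t ranges over E = int
   or over the complex numbers.  The sums are finite as soon as D2, D3, W and
   D1 are truncated from below. *)
Definition co_jacobi (E : pzRingType) (V M1 M2 M3 : lmodType C)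
    (D1 : int -> M1 -> tensor V M1) (D2 : int -> M2 -> tensor V M2)
    (D3 : int -> M3 -> tensor V M3) (W : E -> M3 -> tensor M1 M2) : Prop :=
  forall (l m : int) (t : E) (x : M3),
    \sum_(i \in [set: nat]) ((-1) ^+ i * binz l i) *:
        tmap id (W (t + i%:R)) (D3 (m + l - i%:Z) x)
  - \sum_(i \in [set: nat]) ((-1) ^ l * (-1) ^+ i * binz l i) *:
        tswap (tmap id (D2 (m + i%:Z)) (W (t + l%:~R - i%:R) x))
  = \sum_(i \in [set: nat]) binz m i *:
        tassoc (tmap (D1 (l + i%:Z)) id (W (t + m%:~R - i%:R) x)).

(* The same coefficient in the Jacobi identity for
   W(w, z) = Σ_t w_t z^(-t-1) : N2 -> N3 *)
Definition jacobi (E : pzRingType) (A N1 N2 N3 : lmodType C)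
    (Y1 : int -> A -> N1 -> N1) (Y2 : int -> A -> N2 -> N2)
    (Y3 : int -> A -> N3 -> N3) (W : E -> N1 -> N2 -> N3) : Prop :=
  forall (l m : int) (t : E) (u : A) (w : N1) (x : N2),
    \sum_(i \in [set: nat]) ((-1) ^+ i * binz l i) *:
        Y3 (m + l - i%:Z) u (W (t + i%:R) w x)
  - \sum_(i \in [set: nat]) ((-1) ^ l * (-1) ^+ i * binz l i) *:
        W (t + l%:~R - i%:R) w (Y2 (m + i%:Z) u x)
  = \sum_(i \in [set: nat]) binz m i *:
        W (t + m%:~R - i%:R) (Y1 (l + i%:Z) u w) x.

Definition virasoro (M : lmodType C) (d : C) (L : int -> M -> M) : Prop :=
  forall (k j : int) (x : M),
    L k (L j x) - L j (L k x) =
      (k - j)%:~R *: L (k + j) x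
      + ((k ^+ 3 - k)%:~R / 12%:R * (k + j == 0)%:R * d) *: x.

End Formal.

Record voc_data (R : realType) := VocData {
  voc_space :> lmodType R[i];
  voc_gr : int -> set voc_space;
  voc_delta : int -> {linear voc_space -> tensor voc_space voc_space};
  voc_c : {scalar voc_space};
  voc_rho : {scalar voc_space};
  voc_rank : R[i]
}.
Arguments voc_gr {R} v.
Arguments voc_delta {R} v.
Arguments voc_c {R} v.
Arguments voc_rho {R} v.
Arguments voc_rank {R} v.

Section VOC.
Variables (R : realType) (V : voc_data R).

Local Notation Delta := (voc_delta V).

(* (ρ ⊗ Id) Υ(z) = Σ_k L(k) z^(k-2), where z^(k-2) = z^(-(1-k)-1) *)
Definition voc_L (k : int) (v : V) : V := tforml (voc_rho V) (Delta (1 - k) v).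

Record is_voc : Prop := IsVoc {
  voc_grading : direct_sum (voc_gr V);
  voc_fin_dim : forall s, fin_dim (voc_gr V s);
  voc_lower : exists s0 : int, forall s, (s < s0)%R -> voc_gr V s = [set 0];
  voc_trunc : forall v, exists k0 : int, forall k, (k < k0)%R -> Delta k v = 0;
  voc_delta_gr : forall s k v, voc_gr V s v ->
    tensor_gr id (voc_gr V) (voc_gr V) (s + k + 1) (Delta k v);
  voc_counit : forall k v,
    tforml (voc_c V) (Delta k v) = if k == -1 then v else 0;
  voc_cocreation : forall v, tformr (voc_c V) (Delta (-1) v) = v /\
    forall k, (0 <= k)%R -> tformr (voc_c V) (Delta k v) = 0;
  voc_jacobi : co_jacobi Delta Delta Delta Delta;
  voc_virasoro : virasoro (voc_rank V) voc_L;
  voc_L0 : forall s, voc_gr V s = [set v : V | voc_L 0 v = s%:~R *: v];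
  voc_derivative : forall k v,
    tmap (voc_L 1) id (Delta k v) = (- k)%:~R *: Delta (k - 1) v /\
    (- k)%:~R *: Delta (k - 1) v =
      Delta k (voc_L 1 v) - tmap id (voc_L 1) (Delta k v)
}.

End VOC.

Record comod_data (R : realType) (V : voc_data R) := ComodData {
  cm_space :> lmodType R[i];
  cm_gr : nat -> set cm_space;
  cm_delta : int -> {linear cm_space -> tensor V cm_space}
}.
Arguments cm_gr {R V} c.
Arguments cm_delta {R V} c.

Section Comodules.
Variables (R : realType) (V : voc_data R).

Definition cm_L (M : comod_data V) (k : int) (x : M) : M :=
  tforml (voc_rho V) (cm_delta M (1 - k) x).

Record admissible_comodule (M : comod_data V) : Prop := AdmissibleComodule {
  cm_grading : direct_sum (cm_gr M);
  cm_trunc : forall x : M,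
    exists k0 : int, forall k, (k < k0)%R -> cm_delta M k x = 0;
  cm_counit : forall k (x : M),
    tforml (voc_c V) (cm_delta M k x) = if k == -1 then x else 0;
  cm_jacobi : co_jacobi (voc_delta V) (cm_delta M)
                (cm_delta M) (cm_delta M);
  cm_virasoro : virasoro (voc_rank V) (@cm_L M);
  cm_derivative : forall k (x : M),
    tmap (@voc_L R V 1) id (cm_delta M k x) = (- k)%:~R *: cm_delta M (k - 1) x /\
    (- k)%:~R *: cm_delta M (k - 1) x =
      cm_delta M k (cm_L 1 x) - tmap id (@cm_L M 1) (cm_delta M k x);
  cm_delta_gr : forall t k (x : M), cm_gr M t x ->
    tensor_gr Posz (voc_gr V) (cm_gr M) (t%:Z + k + 1) (cm_delta M k x)
}.

Definition subcomodule (M : comod_data V) (S : set M) : Prop :=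
  [/\ subspace S, homogeneous (cm_gr M) S
    & forall k x, S x ->
        span [set y | exists v z, S z /\ y = v ⊗ z] (cm_delta M k x)].

Definition simple_comodule (M : comod_data V) : Prop :=
  simple_sub (@subcomodule M) setT.

Definition cosemisimple (M : comod_data V) : Prop :=
  semisimple (@subcomodule M).

Definition corational : Prop :=
  forall M : comod_data V, admissible_comodule M -> cosemisimple M.

Definition comodule_hom (M N : comod_data V) (f : M -> N) : Prop :=
  linear f /\ forall k x, cm_delta N k (f x) = tmap id f (cm_delta M k x).

Definition comodule_iso (M N : comod_data V) : Prop :=
  exists f : M -> N, comodule_hom f /\ bijective f.

Definition comodule_ses (M N P : comod_data V) : Prop :=
  exists (f : M -> N) (g : N -> P),
    [/\ comodule_hom f, comodule_hom g, injective f, range g = setT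
      & range f = [set y | g y = 0]].

(* The objects of the category whose Grothendieck group is taken: the finite
   direct sums of simple admissible comodules, i.e. the admissible comodules of
   finite length when V is corational.  With arbitrary direct sums allowed,
   the Grothendieck group would be zero. *)
Definition comodule_obj (M : comod_data V) : Prop :=
  admissible_comodule M /\ fin_semisimple (@subcomodule M).

(* Some s0 such that V_s = 0 for s < s0 *)
Definition voc_low : int :=
  xget 0 [set s0 | forall s, (s < s0)%R -> voc_gr V s = [set 0]].

(* V as an admissible comodule over itself, its grading shifted to start at 0 *)
Definition voc_comodule : comod_data V :=
  @ComodData R V V (fun t => voc_gr V (voc_low + t%:Z)) (voc_delta V).

Definition simple_voc : Prop := simple_comodule voc_comodule.

Definition cointertwining (M1 M2 M3 : comod_data V) :
    set (R[i] -> M3 -> tensor M1 M2) :=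
  [set W : R[i] -> M3 -> tensor M1 M2 |
   [/\ forall t, linear (W t),
       forall x, exists B : R, forall t : R[i],
         (complex.Re t < B)%R -> W t x = 0,
       forall t x, (- t) *: W (t - 1) x = tmap (@cm_L M1 1) id (W t x)
     & co_jacobi (cm_delta M1) (cm_delta M2) (cm_delta M3) W]].

Arguments cointertwining : clear implicits.

(* N^{M1,M2}_{M3} *)
Definition cofusion (M1 M2 M3 : comod_data V) : nat :=
  dim (cointertwining M1 M2 M3).

End Comodules.

Arguments cointertwining {R V} M1 M2 M3.

Record voa_data (C : fieldType) := VoaData {
  voa_space :> lmodType C;
  voa_gr : int -> set voa_space;
  voa_mode : int -> voa_space -> voa_space -> voa_space;
  voa_vac : voa_space;
  voa_conf : voa_space
}.
Arguments voa_gr {C} v.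
Arguments voa_mode {C} v.
Arguments voa_vac {C} v.
Arguments voa_conf {C} v.

Record mod_data (C : fieldType) (A : voa_data C) := ModData {
  md_space :> lmodType C;
  md_gr : nat -> set md_space;
  md_mode : int -> A -> md_space -> md_space
}.
Arguments md_gr {C A} m.
Arguments md_mode {C A} m.

Section Modules.
Variables (R : realType) (A : voa_data R[i]).

Record admissible_module (N : mod_data A) : Prop := AdmissibleModule {
  md_grading : direct_sum (md_gr N);
  md_bilinear : forall k, bilinear_for *:%R *:%R (md_mode N k);
  md_trunc : forall u (x : N),
    exists k0 : int, forall k, (k0 < k)%R -> md_mode N k u x = 0;
  md_vac : forall k (x : N),
    md_mode N k (voa_vac A) x = if k == -1 then x else 0;
  md_jacobi : jacobi (voa_mode A) (md_mode N)
                (md_mode N) (md_mode N);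
  md_mode_gr : forall (r k : int) (t : nat) u (x : N),
    voa_gr A r u -> md_gr N t x ->
    match r + t%:Z - k - 1 with
    | Posz s => md_gr N s (md_mode N k u x)
    | Negz _ => md_mode N k u x = 0
    end
}.

Definition submodule (N : mod_data A) (S : set N) : Prop :=
  [/\ subspace S, homogeneous (md_gr N) S
    & forall k u x, S x -> S (md_mode N k u x)].

Definition module_hom (N P : mod_data A) (f : N -> P) : Prop :=
  linear f /\ forall k u x, f (md_mode N k u x) = md_mode P k u (f x).

Definition module_iso (N P : mod_data A) : Prop :=
  exists f : N -> P, module_hom f /\ bijective f.

Definition module_ses (N P Q : mod_data A) : Prop :=
  exists (f : N -> P) (g : P -> Q),
    [/\ module_hom f, module_hom g, injective f, range g = setT
      & range f = [set y | g y = 0]].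

Definition module_obj (N : mod_data A) : Prop :=
  admissible_module N /\ fin_semisimple (@submodule N).

Definition voa_low : int :=
  xget 0 [set s0 | forall s, (s < s0)%R -> voa_gr A s = [set 0]].

Definition voa_module : mod_data A :=
  @ModData _ A A (fun t => voa_gr A (voa_low + t%:Z)) (voa_mode A).

(* Intertwining operators of type (N3 ; N1 N2).  L(-1) acts on N1 as the mode
   of index 0 of the conformal vector. *)
Definition intertwining (N1 N2 N3 : mod_data A) :
    set (R[i] -> N1 -> N2 -> N3) :=
  [set W : R[i] -> N1 -> N2 -> N3 |
   [/\ forall t, bilinear_for *:%R *:%R (W t),
       forall w x, exists B : R, forall t : R[i],
         (B < complex.Re t)%R -> W t w x = 0,
       forall t w x, W t (md_mode N1 0 (voa_conf A) w) x = (- t) *: W (t - 1) w x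
     & jacobi (md_mode N1) (md_mode N2) (md_mode N3) W]].

Arguments intertwining : clear implicits.

(* N^{N3}_{N1,N2} *)
Definition fusion (N1 N2 N3 : mod_data A) : nat :=
  dim (intertwining N1 N2 N3).

End Modules.

Arguments intertwining {R A} N1 N2 N3.

Section Duals.
Variables (R : realType) (V : voc_data R).

(* (Y(f,z)g, v) = (f ⊗ g, Υ(z)v) *)
Definition dual_voa : voa_data R[i] :=
  @VoaData _ (gdual (voc_gr V))
    (gdual_gr (gr := voc_gr V))
    (fun k f g => to_gdual _ (fun v => tform f g (voc_delta V k v)))
    (to_gdual _ (voc_c V)) (to_gdual _ (voc_rho V)).

Definition dual_module (M : comod_data V) : mod_data dual_voa :=
  @ModData _ dual_voa (gdual (cm_gr M))
    (gdual_gr (gr := cm_gr M))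
    (fun k (f : gdual (voc_gr V)) g =>
       to_gdual _ (fun x => tform f g (cm_delta M k x))).

End Duals.

(* Complexified Grothendieck groups: C ⊗_Z K, characterised by the universal  *)
(* property that the maps from objects to C-vector spaces which are invariant *)
(* under isomorphism and additive on short exact sequences factor uniquely.   *)

Section Grothendieck.
Variables (C : fieldType) (Ob : Type) (obj : Ob -> Prop).
Variables (iso : Ob -> Ob -> Prop) (ses : Ob -> Ob -> Ob -> Prop).

Definition additive_class (L : lmodType C) (f : Ob -> L) : Prop :=
  (forall X Y, obj X -> obj Y -> iso X Y -> f X = f Y) /\
  (forall X Y Z, obj X -> obj Y -> obj Z -> ses X Y Z -> f Y = f X + f Z).

Definition grothendieck (K : lmodType C) (cls : Ob -> K) : Prop :=
  additive_class cls /\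
  forall (L : lmodType C) (f : Ob -> L), additive_class f ->
    (exists phi : {linear K -> L}, forall X, obj X -> phi (cls X) = f X) /\
    (forall phi psi : {linear K -> L},
       (forall X, obj X -> phi (cls X) = f X) ->
       (forall X, obj X -> psi (cls X) = f X) -> phi =1 psi).

End Grothendieck.

Section DualStructures.
Variables (C : fieldType) (A K : lmodType C).
Variable pair : A -> K -> C.
Variables (mul : A -> A -> A) (one : A).
Variables (Delta : K -> tensor K K) (eps : K -> C).

(* f |-> pair f is an isomorphism of A, with mul and one, onto the dual K^*,
   with the product (f g)(a) = (f ⊗ g)(Delta a) and the unit eps *)
Definition is_dual_algebra : Prop :=
  [/\ forall phi : {scalar K}, exists! f : A, forall a, pair f a = phi a,
      forall f g a, pair (mul f g) a = tform (pair f) (pair g) (Delta a)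
    & forall a, pair one a = eps a].

(* a |-> pair^~ a is an isomorphism of K, with Delta and eps, onto the dual
   A^*, with (Delta phi, f ⊗ g) = phi (f g) and the counit phi |-> phi one *)
Definition is_dual_coalgebra : Prop :=
  [/\ forall phi : {scalar A}, exists! a : K, forall f, pair f a = phi f,
      forall a f g, tform (pair f) (pair g) (Delta a) = pair (mul f g) a
    & forall a, eps a = pair one a].

Definition dual_bases (I : finType) (e' : I -> A) (e : I -> K) : Prop :=
  [/\ is_basis e, is_basis e' & forall i j, pair (e' i) (e j) = (i == j)%:R].

End DualStructures.

(* Main.v *)
Require Import Defs.
From HB Require Import structures.
From mathcomp Require Import all_boot all_order all_algebra.
From mathcomp Require Import sesquilinear complex boolp classical_sets functions.
From mathcomp Require Import reals cardinality fsbigop ring zify.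

Import Order.TTheory GRing.Theory Num.Theory.

Set Implicit Arguments.
Unset Strict Implicit.
Unset Printing Implicit Defensive.

Local Open Scope classical_set_scope.
Local Open Scope ring_scope.

(** Let M' be the graded dual of a comodule M.  On the bases [M^i] and [(M^i)']
    both claims say that the structure constants agree: transposing the product
    of K[C^op] gives the coproduct of K[C] as soon as
      N^(M^i, M^j)_(M^k) = N^((M^k)')_((M^i)', (M^j)'),
    and the units agree as soon as [V'] is the basis vector dual to the class of
    V.  The rest is bilinear extension through the perfect pairing.

    The equality of fusion rules ([cofusion_fusion]) comes from the bijection
    that sends a cointertwining operator W to the operator Y with
      (Y_t(f) g)(x) = (f ⊗ g)(W_t x).
    Evaluated at u ⊗ (f ⊗ g), the two Jacobi identities and the two
    L(1)-derivative properties are literally the same equations, and the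
    functionals f ⊗ g in the graded duals separate tensors
    ([co_jacobi_at], [transpose_jacobi], [tensor_separated]).  What has to be
    shown is that transposes exist in both directions, namely that
    x |-> (f ⊗ g)(W_t x) vanishes in almost all degrees, and that
    (f, g) |-> (Y_t(f) g)(x) is given by a tensor.

    Both follow from a degree count.  On a simple comodule with finite
    dimensional homogeneous components L(0) acts as h + n in degree n, by
    Schur's lemma ([simple_weight_graded]).  The component of the Jacobi identity
    that computes the commutator with L(0) ([jacobi_at01], [L0_commutator])
    then shows that only degrees with t = h1 + h2 - h3 - 1 + a + b - n
    contribute to (f ⊗ g)(W_t x), where a, b, n are the degrees of f, g, x.
    For fixed t and n there are finitely many such (a, b)
    ([form_represented]); for fixed t, f, g there are finitely many such n
    ([form_gdual]); and the truncation conditions hold on either side for free.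

    For the unit, V is isomorphic to one of the M^i, but an isomorphism of
    comodules need not respect the gradings.  It commutes with L(0), and the
    graded dual can be described by L(0)-weights alone ([gdual_weightP]); so
    isomorphic comodules have isomorphic duals ([dual_iso]).  Invariance of
    classes under isomorphism applies to modules of finite length, so the
    duals of simple comodules also have to be shown to be simple admissible
    modules ([dual_obj]): annihilators exchange subobjects. *)

(** * Linear maps and finitely supported sums *)

Lemma fsum_seq (W : zmodType) (I : choiceType) (E : I -> W) (r : seq I) :
  uniq r -> (forall i, i \notin r -> E i = 0) ->
  \sum_(i \in [set: I]) E i = \sum_(i <- r) E i.
Proof.
move=> ur Er; rewrite (@fsbigE _ _ _ _ _ r) //; last by move=> i _; exact: Er.
by apply: eq_bigl => i; rewrite in_setT.
Qed.

Section LinearFor.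
Variables (F : fieldType) (U : lmodType F) (W : zmodType).
Variables (s : GRing.Scale.law F W) (f : U -> W) (lf : linear_for s f).

Let g : {linear U -> W | s} := HB.pack f (GRing.isLinear.Build F U W s f lf).

Lemma lin0 : f 0 = 0. Proof. exact: (linear0 g). Qed.
Lemma linD : {morph f : x y / x + y}. Proof. exact: (linearD g). Qed.
Lemma linB : {morph f : x y / x - y}. Proof. exact: (linearB g). Qed.
Lemma linZ a x : f (a *: x) = s a (f x). Proof. exact: (linearZ_LR g). Qed.
Lemma lin_sum I (r : seq I) (E : I -> U) :
  f (\sum_(i <- r) E i) = \sum_(i <- r) f (E i).
Proof. exact: (linear_sum g). Qed.

Lemma lin_fsum (I : choiceType) (E : I -> U) : finite_set [set i | E i != 0] ->
  f (\sum_(i \in [set: I]) E i) = \sum_(i \in [set: I]) f (E i).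
Proof.
move=> /finite_seqP [r0 fin]; pose r := undup r0.
have rN i : i \notin r -> E i = 0.
  rewrite mem_undup => /negP ri; apply/eqP/negPn/negP => Ei.
  by apply: ri; have : [set i | E i != 0] i by []; rewrite fin.
rewrite (@fsum_seq _ _ E r) ?undup_uniq // lin_sum.
rewrite (@fsum_seq _ _ _ r) ?undup_uniq //.
by move=> i /rN ->; exact: lin0.
Qed.

End LinearFor.

(** * Tensor calculus *)

Section TensorCalculus.
Variable F : fieldType.
Implicit Types U V W : lmodType F.

Lemma tens0 V W (v : V) : v ⊗ (0 : W) = 0.
Proof. exact: (lin0 ((tens_bilinear V W).2 v)). Qed.

Lemma tens_sumr V W (v : V) I (r : seq I) (E : I -> W) :
  v ⊗ (\sum_(i <- r) E i) = \sum_(i <- r) v ⊗ E i.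
Proof. exact: (lin_sum ((tens_bilinear V W).2 v)). Qed.

Lemma tens_suml V W (w : W) I (r : seq I) (E : I -> V) :
  (\sum_(i <- r) E i) ⊗ w = \sum_(i <- r) E i ⊗ w.
Proof. exact: (lin_sum ((tens_bilinear V W).1 w)). Qed.

Lemma tensZ V W a (v : V) (w : W) : (a *: v) ⊗ w = v ⊗ (a *: w).
Proof.
by rewrite (linZ ((tens_bilinear V W).1 w)) (linZ ((tens_bilinear V W).2 v)).
Qed.

Lemma tensE V W (y : tensor V W) : y = \sum_(p <- rtensor y) p.1 ⊗ p.2.
Proof.
apply: tensor_eqP => U b Hb; rewrite (lin_sum (tlift_linear Hb)).
by rewrite {1}/tlift /tsum; apply: eq_bigr => p _; rewrite tlift_tens.
Qed.

Lemma tensor_ext V W (E : zmodType) (s : GRing.Scale.law F E)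
    (f g : tensor V W -> E) :
  linear_for s f -> linear_for s g ->
  (forall v w, f (v ⊗ w) = g (v ⊗ w)) -> f =1 g.
Proof.
move=> lf lg fg y; rewrite [y]tensE (lin_sum lf) (lin_sum lg).
by apply: eq_bigr => p _.
Qed.

Section Forms.
Variables (V W : lmodType F) (f : V -> F) (g : W -> F).
Hypotheses (lf : scalar f) (lg : scalar g).

Lemma tform_bilin :
  bilinear_for *:%R *:%R (fun v w => f v * g w : F^o).
Proof.
split=> [w|v] a x y /=; first by rewrite lf /GRing.scale /= mulrDl mulrA.
by rewrite lg /GRing.scale /= mulrDr mulrCA.
Qed.

Lemma tform_scalar : scalar (tform f g).
Proof. exact: (tlift_linear tform_bilin). Qed.

Lemma tform_tens v w : tform f g (v ⊗ w) = f v * g w.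
Proof. exact: (tlift_tens tform_bilin). Qed.

Lemma tforml_bilin : bilinear_for *:%R *:%R (fun v (w : W) => f v *: w).
Proof.
split=> [w|v] a x y /=; first by rewrite lf scalerDl scalerA.
by rewrite scalerDr !scalerA mulrC.
Qed.

Lemma tforml_linear : linear (tforml (W := W) f).
Proof. exact: (tlift_linear tforml_bilin). Qed.

Lemma tforml_tens v (w : W) : tforml f (v ⊗ w) = f v *: w.
Proof. exact: (tlift_tens tforml_bilin). Qed.

Lemma tformr_bilin : bilinear_for *:%R *:%R (fun (v : V) w => g w *: v).
Proof.
split=> [w|v] a x y /=; last by rewrite lg scalerDl scalerA.
by rewrite scalerDr !scalerA mulrC.
Qed.

Lemma tformr_linear : linear (tformr (V := V) g).
Proof. exact: (tlift_linear tformr_bilin). Qed.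

Lemma tformr_tens (v : V) w : tformr g (v ⊗ w) = g w *: v.
Proof. exact: (tlift_tens tformr_bilin). Qed.

End Forms.

Lemma scalar_comp U V (f : U -> V) (g : V -> F) :
  linear f -> scalar g -> scalar (fun x => g (f x)).
Proof. by move=> lf lg a x y; rewrite lf lg. Qed.

Lemma linear_comp U V W (f : U -> V) (g : V -> W) :
  linear f -> linear g -> linear (fun x => g (f x)).
Proof. by move=> lf lg a x y; rewrite lf lg. Qed.

Lemma tforml_form V W (f : V -> F) (g : W -> F) y : scalar f -> scalar g ->
  g (tforml f y) = tform f g y.
Proof.
move=> lf lg; move: y; apply: (tensor_ext (s := *%R)).
- exact: scalar_comp (tforml_linear lf) lg.
- exact: tform_scalar.
- by move=> v w; rewrite tforml_tens // tform_tens // (linZ lg).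
Qed.

Lemma tformr_form V W (f : V -> F) (g : W -> F) y : scalar f -> scalar g ->
  f (tformr g y) = tform f g y.
Proof.
move=> lf lg; move: y; apply: (tensor_ext (s := *%R)).
- exact: scalar_comp (tformr_linear lg) lf.
- exact: tform_scalar.
- by move=> v w; rewrite tformr_tens // tform_tens // (linZ lf) /= mulrC.
Qed.

Section Maps.
Variables (V W V' W' : lmodType F) (a : V -> V') (b : W -> W').
Hypotheses (la : linear a) (lb : linear b).

Lemma tmap_bilin : bilinear_for *:%R *:%R (fun v w => a v ⊗ b w).
Proof.
by split=> [w|v] c x y /=; rewrite ?la ?lb;
  [exact: (tens_bilinear _ _).1 | exact: (tens_bilinear _ _).2].
Qed.

Lemma tmap_linear : linear (tmap a b).
Proof. exact: (tlift_linear tmap_bilin). Qed.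

Lemma tmap_tens v w : tmap a b (v ⊗ w) = a v ⊗ b w.
Proof. exact: (tlift_tens tmap_bilin). Qed.

Lemma tform_map f g y : scalar f -> scalar g ->
  tform f g (tmap a b y) = tform (fun v => f (a v)) (fun w => g (b w)) y.
Proof.
move=> lf lg; move: y; apply: (tensor_ext (s := *%R)).
- exact: scalar_comp tmap_linear (tform_scalar lf lg).
- by apply: tform_scalar; exact: scalar_comp.
- move=> v w; rewrite tmap_tens !tform_tens //; exact: scalar_comp.
Qed.

Lemma tforml_map f y : scalar f ->
  tforml f (tmap a b y) = b (tforml (fun v => f (a v)) y).
Proof.
move=> lf; move: y; apply: (tensor_ext (s := *:%R)).
- exact: linear_comp tmap_linear (tforml_linear lf).
- by apply: linear_comp lb; apply: tforml_linear; exact: scalar_comp.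
- move=> v w; rewrite tmap_tens !tforml_tens ?(linZ lb) //.
  exact: scalar_comp.
Qed.

End Maps.

Section Rearrange.
Variables (U V W : lmodType F) (u : U -> F) (f : V -> F) (g : W -> F).
Hypotheses (lu : scalar u) (lf : scalar f) (lg : scalar g).

Lemma tswap_inner_bilin (x : U) :
  bilinear_for *:%R *:%R (fun (v : V) (w : W) => v ⊗ (x ⊗ w)).
Proof.
split=> [w|v] c y z /=; first exact: (tens_bilinear _ _).1.
by rewrite ((tens_bilinear _ _).2 x c) ((tens_bilinear _ _).2 v).
Qed.

Lemma tswap_bilin : bilinear_for *:%R *:%R
  (fun (x : U) (y : tensor V W) => tlift (fun v w => v ⊗ (x ⊗ w)) y).
Proof.
split=> [w|v] c y z /=; last exact: (tlift_linear (tswap_inner_bilin v)).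
rewrite /tlift /tsum scaler_sumr -big_split; apply: eq_bigr => p _ /=.
by rewrite ((tens_bilinear _ _).1 p.2) ((tens_bilinear _ _).2 p.1).
Qed.

Lemma tswap_linear : linear (@tswap F U V W).
Proof. exact: (tlift_linear tswap_bilin). Qed.

Lemma tswap_tens x v w : tswap (x ⊗ (v ⊗ w)) = v ⊗ (x ⊗ w)
  :> tensor V (tensor U W).
Proof.
by rewrite /tswap (tlift_tens tswap_bilin) (tlift_tens (tswap_inner_bilin x)).
Qed.

Lemma tassoc_inner_bilin (w : W) :
  bilinear_for *:%R *:%R (fun (x : U) (v : V) => x ⊗ (v ⊗ w)).
Proof.
split=> [v|x] c y z /=; first exact: (tens_bilinear _ _).1.
by rewrite ((tens_bilinear _ _).1 w c) ((tens_bilinear _ _).2 x).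
Qed.

Lemma tassoc_bilin : bilinear_for *:%R *:%R
  (fun (y : tensor U V) (w : W) => tlift (fun x v => x ⊗ (v ⊗ w)) y).
Proof.
split=> [w|v] c y z /=; first exact: (tlift_linear (tassoc_inner_bilin w)).
rewrite /tlift /tsum scaler_sumr -big_split; apply: eq_bigr => p _ /=.
by rewrite ((tens_bilinear _ _).2 p.2) ((tens_bilinear _ _).2 p.1).
Qed.

Lemma tassoc_linear : linear (@tassoc F U V W).
Proof. exact: (tlift_linear tassoc_bilin). Qed.

Lemma tassoc_tens x v w : tassoc ((x ⊗ v) ⊗ w) = x ⊗ (v ⊗ w)
  :> tensor U (tensor V W).
Proof.
by rewrite /tassoc (tlift_tens tassoc_bilin) (tlift_tens (tassoc_inner_bilin w)).
Qed.

Lemma tform_swap (y : tensor U (tensor V W)) :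
  tform f (tform u g) (tswap y) = tform u (tform f g) y.
Proof.
have l1 := tform_scalar lu lg; have l2 := tform_scalar lf lg.
move: y; apply: (tensor_ext (s := *%R)).
- exact: scalar_comp tswap_linear (tform_scalar lf l1).
- exact: tform_scalar.
move=> x; apply: (tensor_ext (s := *%R)).
- exact: scalar_comp ((tens_bilinear _ _).2 x)
    (scalar_comp tswap_linear (tform_scalar lf l1)).
- exact: scalar_comp ((tens_bilinear _ _).2 x) (tform_scalar lu l2).
by move=> v w; rewrite tswap_tens !tform_tens // mulrCA.
Qed.

Lemma tform_assoc (y : tensor (tensor U V) W) :
  tform u (tform f g) (tassoc y) = tform (tform u f) g y.
Proof.
have l1 := tform_scalar lf lg; have l2 := tform_scalar lu lf.
move: y; apply: (tensor_ext (s := *%R)).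
- exact: scalar_comp tassoc_linear (tform_scalar lu l1).
- exact: tform_scalar.
move=> z w; move: z; apply: (tensor_ext (s := *%R)).
- exact: scalar_comp ((tens_bilinear _ _).1 w)
    (scalar_comp tassoc_linear (tform_scalar lu l1)).
- exact: scalar_comp ((tens_bilinear _ _).1 w) (tform_scalar l2 lg).
by move=> x v; rewrite tassoc_tens !tform_tens // mulrA.
Qed.

End Rearrange.

Lemma tform_linl V W a (f f' : V -> F) (g : W -> F) y :
  tform (fun v => a * f v + f' v) g y = a * tform f g y + tform f' g y.
Proof.
rewrite /tform /tlift /tsum mulr_sumr -big_split.
by apply: eq_bigr => p _ /=; rewrite mulrDl mulrA.
Qed.

Lemma tform_linr V W a (f : V -> F) (g g' : W -> F) y :
  tform f (fun w => a * g w + g' w) y = a * tform f g y + tform f g' y.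
Proof.
rewrite /tform /tlift /tsum mulr_sumr -big_split.
by apply: eq_bigr => p _ /=; rewrite mulrDr mulrCA.
Qed.

End TensorCalculus.

(** * Spans, functionals and eigenvectors *)

Section Subspaces.
Variables (F : fieldType) (V : lmodType F).
Implicit Types (S T E : set V) (s : seq V).

Lemma subspaceZ S a x : subspace S -> S x -> S (a *: x).
Proof. by move=> [S0 Sl] Sx; have := Sl a x 0 Sx S0; rewrite addr0. Qed.

Lemma subspaceD S x y : subspace S -> S x -> S y -> S (x + y).
Proof. by move=> [S0 Sl] Sx Sy; have := Sl 1 x y Sx Sy; rewrite scale1r. Qed.

Lemma subspaceB S x y : subspace S -> S x -> S y -> S (x - y).
Proof.
by move=> [S0 Sl] Sx Sy; have := Sl (-1) y x Sy Sx; rewrite scaleN1r addrC.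
Qed.

Lemma subspace_sum S (I : eqType) (r : seq I) (E : I -> V) : subspace S ->
  (forall i, i \in r -> S (E i)) -> S (\sum_(i <- r) E i).
Proof.
move=> Ss; elim: r => [|i r IH] H; first by rewrite big_nil; exact: Ss.1.
rewrite big_cons; apply: subspaceD => //; first exact/H/mem_head.
by apply: IH => j jr; apply: H; rewrite inE jr orbT.
Qed.

Lemma span_subspace S : subspace (Defs.span S).
Proof.
split; first by exists [::]; split=> //; rewrite big_nil.
move=> a x y [s [sS ->]] [t [tS ->]].
exists ([seq (a * p.1, p.2) | p <- s] ++ t); split.
  move=> p; rewrite mem_cat => /orP [/mapP [q qs ->]|/tS //]; exact: (sS q).
rewrite big_cat big_map scaler_sumr; congr (_ + _).
by apply: eq_bigr => p _; rewrite scalerA.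
Qed.

Lemma mem_span S x : S x -> Defs.span S x.
Proof.
move=> Sx; exists [:: (1, x)]; split; last by rewrite big_seq1 scale1r.
by move=> p; rewrite inE => /eqP ->.
Qed.

Lemma span_min S T : subspace T -> S `<=` T -> Defs.span S `<=` T.
Proof.
move=> Ts ST x [s [sS ->]]; apply: subspace_sum => // p /sS /ST.
exact: subspaceZ.
Qed.

Lemma span_cons v s y : Defs.span [set` v :: s] y ->
  exists c, Defs.span [set` s] (y - c *: v).
Proof.
pose T : set V := [set z | exists c, Defs.span [set` s] (z - c *: v)].
have [sp0 spl] := span_subspace [set` s].
suff: Defs.span [set` v :: s] `<=` T by apply.
apply: span_min.
  split; first by exists 0; rewrite scale0r subr0.
  move=> a x z [c Hc] [d Hd]; exists (a * c + d).
  have := spl a _ _ Hc Hd; congr (Defs.span _ _).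
  by rewrite scalerBr scalerA scalerDl opprD addrACA.
move=> z /=; rewrite inE => /orP [/eqP ->|zs].
  by exists 1; rewrite scale1r subrr.
by exists 0; rewrite scale0r subr0; apply: mem_span.
Qed.

Lemma span_nth s y : Defs.span [set` s] y ->
  exists c : 'I_(size s) -> F, y = \sum_j c j *: nth 0 s j.
Proof.
elim: s y => [|v s IH] y.
  move=> [r [r0 ->]]; exists (fun=> 0); rewrite big_ord0 big_seq big1 // => p.
  by move=> /r0.
move=> /span_cons [c /IH [d Hd]].
exists (fun j => oapp d c (unlift ord0 j)).
rewrite big_ord_recl unlift_none /= -[LHS](subrK (c *: v)) Hd addrC.
by congr (_ + _); apply: eq_bigr => j _; rewrite liftK.
Qed.

End Subspaces.

Section Functionals.
Variables (F : fieldType) (V : lmodType F).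

Definition scalar_on (E : set V) (u : V -> F) : Prop :=
  forall a x y, E x -> E y -> u (a *: x + y) = a * u x + u y.

(** Modulo S the space E is the line through e, and l is the coordinate on this
    line. *)
Lemma coordinate_along (S E : set V) (v e : V) : subspace S -> subspace E ->
  (forall y, E y -> exists c, S (y - c *: v)) -> E e -> ~ S e ->
  exists l : V -> F, [/\ scalar_on E l, l e = 1,
    forall y, E y -> S (y - l y *: e) & forall y, E y -> S y -> l y = 0].
Proof.
move=> Ss Es Ev Ee Se.
have l_uniq y c d : S (y - c *: e) -> S (y - d *: e) -> c = d.
  move=> Sc Sd; apply/eqP/negPn/negP => cd; apply: Se.
  have := subspaceZ (d - c)^-1 Ss (subspaceB Ss Sc Sd).
  have -> : y - c *: e - (y - d *: e) = (d - c) *: e.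
    by rewrite opprB addrC addrA subrK scalerBl.
  by rewrite scalerA mulVf ?scale1r // subr_eq0 eq_sym.
have l_ex y : exists c, E y -> S (y - c *: e).
  have [Ey|nEy] := pselect (E y); last by exists 0.
  have [c Sc] := Ev y Ey; have [d Sd] := Ev e Ee.
  have d0 : d != 0.
    by apply/eqP => d0; apply: Se; move: Sd; rewrite d0 scale0r subr0.
  exists (c / d) => _; have := subspaceB Ss Sc (subspaceZ (c / d) Ss Sd).
  by rewrite scalerBr scalerA divfK // opprB addrA subrK.
pose l y := projT1 (cid (l_ex y)).
have lP y : E y -> S (y - l y *: e) by exact: (projT2 (cid (l_ex y))).
exists l; split => //.
- move=> a x y Ex Ey; apply: (l_uniq (a *: x + y)); first exact/lP/Es.2.
  have := Ss.2 a _ _ (lP x Ex) (lP y Ey).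
  by rewrite scalerBr scalerDl scalerA opprD addrACA.
- by apply: (l_uniq e); [exact: lP | rewrite scale1r subrr; exact: Ss.1].
- by move=> y Ey Sy; apply: (l_uniq y); [exact: lP | rewrite scale0r subr0].
Qed.

(** Extending functionals from an arbitrary subspace would need a basis; for a
    finite-dimensional E it is enough to remove the vectors of a spanning list
    one at a time. *)
Lemma fin_dim_functional (E : set V) x :
  subspace E -> fin_dim E -> E x -> x != 0 ->
  exists2 u : V -> F, scalar_on E u & u x != 0.
Proof.
move=> Es [s]; elim: s E Es x => [|v s IH] E Es x Ess Ex x0.
  have [r [r0 xE]] := Ess x Ex; case/eqP: x0; rewrite xE big_seq big1 // => p.
  by move=> /r0.
pose S := Defs.span [set` s]; have Ss : subspace S := span_subspace _.
have Ev y : E y -> exists c, S (y - c *: v) by move=> /Ess /span_cons.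
have [Sx|nSx] := pselect (S x); last first.
  have [l [ll lx _ _]] := coordinate_along Ss Es Ev Ex nSx.
  by exists l; rewrite // lx oner_neq0.
have [ES|] := pselect (E `<=` S); first exact: (IH E).
move=> /existsNP [e /not_implyP [Ee Se]].
have [l [ll le lS l0]] := coordinate_along Ss Es Ev Ee Se.
have E's : subspace (E `&` S).
  split; first by split; [exact: Es.1 | exact: Ss.1].
  by move=> a y z [Ey Sy] [Ez Sz]; split; [exact: Es.2 | exact: Ss.2].
have [//|u lu ux] := IH (E `&` S) E's x (@subIsetr _ _ _) _ x0.
exists (fun y => u (y - l y *: e)); last by rewrite l0 // scale0r subr0.
have E'l y : E y -> (E `&` S) (y - l y *: e).
  by move=> Ey; split; [exact: subspaceB (subspaceZ _ _ _) | exact: lS].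
move=> a y z Ey Ez; rewrite ll // -lu; [|exact: E'l..]; congr (u _).
by rewrite scalerBr scalerDl scalerA opprD addrACA.
Qed.

Definition functional_space (A : set (V -> F)) : Prop :=
  (forall u, A u -> scalar u) /\
  forall a u u', A u -> A u' -> A (fun x => a * u x + u' x).

Definition separating (A : set (V -> F)) : Prop :=
  forall x, (forall u, A u -> u x = 0) -> x = 0.

(** Gram-Schmidt with respect to a separating space of functionals: the map
    x |-> sum of the p.2 x *: p.1 is a projection, and a vector v that it does
    not fix is dealt with by a functional that detects its defect. *)
Lemma dual_frame (A : set (V -> F)) (s : seq V) :
  functional_space A -> separating A ->
  exists r : seq (V * (V -> F)), (forall p, p \in r -> A p.2) /\
    forall x, Defs.span [set` s] x -> x = \sum_(p <- r) p.2 x *: p.1.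
Proof.
move=> [Al Ac] Asep; suff [r [rA rs]] : exists r : seq (V * (V -> F)),
    (forall p, p \in r -> A p.2) /\
    forall x, x \in s -> x = \sum_(p <- r) p.2 x *: p.1.
  exists r; split=> //; apply: span_min => //; split.
    by rewrite big_seq big1 // => p /rA /Al lp; rewrite (lin0 lp) scale0r.
  move=> a x y {1}-> {1}->; rewrite scaler_sumr -big_split /= !big_seq.
  apply: eq_bigr => p /rA /Al lp; rewrite lp scalerDl scalerA; congr (_ + _).
elim: s => [|v s [r [rA rs]]]; first by exists [::].
pose P x := \sum_(p <- r) p.2 x *: p.1.
have [Pv|Pv] := eqVneq (v - P v) 0.
  exists r; split=> // x; rewrite inE => /orP [/eqP ->|/rs //].
  by apply/eqP; rewrite -subr_eq0; apply/eqP.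
have [u Au uv] : exists2 u, A u & u (v - P v) != 0.
  apply: contrapT => H; case/eqP: Pv; apply: Asep => u Au.
  by apply/eqP/negPn/negP => ue; apply: H; exists u.
(* The new pair projects onto the defect of v along the kernel of the old
   projection; c normalizes the functional to be 1 on it. *)
set c := (u (v - P v))^-1.
have Au' (d : F) : A (fun x => u x * d - \sum_(p <- r) p.2 x * (d * u p.1)).
  elim: (r) rA => [|p t IH] tA.
    have := Ac (d - 1) _ _ Au Au; congr A; apply/funext => x.
    by rewrite big_nil subr0 mulrBl mul1r subrK mulrC.
  have tA' q : q \in t -> A q.2 by move=> qt; apply: tA; rewrite inE qt orbT.
  have := Ac (- (d * u p.1)) _ _ (tA p (mem_head _ _)) (IH tA').
  congr A; apply/funext => x.
  by rewrite big_cons mulNr opprD addrCA [d * _ * _]mulrC.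
exists ((v - P v, fun x => u x * c - \sum_(p <- r) p.2 x * (c * u p.1)) :: r).
split=> [p|x]; first by rewrite inE => /orP [/eqP ->|/rA //]; exact: Au'.
have uE y : u y * c - \sum_(p <- r) p.2 y * (c * u p.1) = c * u (y - P y).
  rewrite (linB (Al u Au)) mulrBr mulrC; congr (_ - _).
  rewrite (lin_sum (Al u Au)) mulr_sumr; apply: eq_bigr => p _.
  by rewrite (linZ (Al u Au)) /= mulrCA.
rewrite inE big_cons /= uE => /orP [/eqP ->|/rs xP].
  by rewrite /c mulVf // scale1r subrK.
by rewrite {2}xP subrr (lin0 (Al u Au)) mulr0 scale0r add0r.
Qed.

End Functionals.

Section TensorFrame.
Variables (F : fieldType) (V W : lmodType F).

(** Writing a tensor over linearly independent left factors would do, but a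
    projection that fixes all left factors of one representation is as good. *)
Lemma tensor_frame (A : set (V -> F)) (y : tensor V W) :
  functional_space A -> separating A ->
  exists r : seq (V * (V -> F)), (forall p, p \in r -> A p.2) /\
    y = \sum_(p <- r) p.1 ⊗ tforml p.2 y.
Proof.
move=> Af As; have [r [rA rP]] := dual_frame (map fst (rtensor y)) Af As.
exists r; split=> //; rewrite {1}[y]tensE.
under [RHS]eq_bigr => p _ do rewrite /tforml /tlift /tsum tens_sumr.
rewrite exchange_big; apply: eq_big_seq => q qy.
rewrite {1}(rP q.1); last by apply: mem_span; exact: (map_f fst).
by rewrite tens_suml; apply: eq_bigr => p _; rewrite tensZ.
Qed.

(** With y written as in [tensor_frame], the right factors are contractions of y,
    which the functionals in B see to be zero. *)
Lemma tensor_separated (A : set (V -> F)) (B : set (W -> F)) :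
  functional_space A -> separating A -> functional_space B -> separating B ->
  forall y : tensor V W,
    (forall u f, A u -> B f -> tform u f y = 0) -> y = 0.
Proof.
move=> Af As Bf Bs y H; have [r [rA ->]] := tensor_frame y Af As.
rewrite big_seq big1 // => p /rA Ap; rewrite [tforml _ _]Bs ?tens0 // => f Bf'.
by rewrite tforml_form ?H //; [exact: Af.1 | exact: Bf.1].
Qed.

End TensorFrame.

Section Eigenvector.
Variables (F : closedFieldType) (V : lmodType F) (L : V -> V).
Hypothesis lL : linear L.

Let act (N : nat) (p : {poly F}) (x : V) := \sum_(i < N) p`_i *: iter i L x.
Let factors (r : seq F) (x : V) := foldr (fun z y => L y - z *: y) x r.

Let act_factors r N x : (size r < N)%N ->
  act N (\prod_(z <- r) ('X - z%:P)) x = factors r x.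
Proof.
elim: r N => [|z r IH] [|N] //= rN.
  rewrite big_nil /act big_ord_recl coef1 eqxx scale1r big1 ?addr0 //.
  by move=> i _; rewrite coef1 scale0r.
rewrite big_cons; set q := \prod_(_ <- _) _.
rewrite -/(factors r x) -{1}(IH N) // -(IH N.+1) ?(ltnW rN) //.
rewrite /act (lin_sum lL) scaler_sumr -/q.
under eq_bigr => i _.
  rewrite mulrBl coefB coefXM coefCM scalerBl -scalerA; over.
rewrite sumrB; congr (_ - _); rewrite big_ord_recl /= scale0r add0r.
by apply: eq_bigr => i _; rewrite (linZ lL).
Qed.

(** The powers of L applied to x span a finite-dimensional space, so some
    nonzero polynomial in L kills x; it splits into linear factors. *)
Lemma eigenvector (E : set V) (x : V) :
  subspace E -> fin_dim E -> (forall y, E y -> E (L y)) -> E x -> x != 0 ->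
  exists y, [/\ E y, y != 0 & exists l, L y = l *: y].
Proof.
move=> Es [s sE] EL Ex x0; set n := size s.
have Ei i : E (iter i L x) by elim: i => //= i; exact: EL.
have cP i := cid (span_nth (sE _ (Ei i))).
pose C : 'M[F]_(n.+1, n) := \matrix_(i, j) projT1 (cP i) j.
have [v vC v0] : exists2 v : 'rV_n.+1, v *m C = 0 & v != 0.
  have /rowV0Pn [v vC v0] : kermx C != 0.
    rewrite kermx_eq0 /row_free neq_ltn ltnS.
    by rewrite (leq_trans (rank_leq_col C)).
  by exists v => //; apply/sub_kermxP.
pose p := \poly_(i < n.+1) v 0 (inord i).
have p0 : p != 0.
  apply: contra_neq v0 => p0; apply/rowP => i; rewrite mxE.
  have := coef_poly n.+1 (fun i => v 0 (inord i)) i.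
  by rewrite -/p p0 coef0 ltn_ord inord_val.
have px : act n.+1 p x = 0.
  rewrite /act; under eq_bigr => i _.
    rewrite coef_poly ltn_ord inord_val (projT2 (cP i)) scaler_sumr.
    under eq_bigr => j _ do rewrite scalerA.
    over.
  rewrite exchange_big big1 // => j _; rewrite -scaler_suml.
  have /rowP/(_ j) := vC; rewrite !mxE => vCj.
  rewrite [X in X *: _](_ : _ = 0) ?scale0r // -[RHS]vCj.
  by apply: eq_bigr => i _; rewrite mxE.
have [r rE] := closed_field_poly_normal p.
have : factors r x = 0.
  have lp : lead_coef p != 0 by rewrite lead_coef_eq0.
  have sr : (size r < n.+1)%N.
    have := size_poly n.+1 (fun i => v 0 (inord i)); rewrite -/p {1}rE.
    by rewrite size_scale // size_prod_XsubC.
  rewrite -(act_factors _ sr); apply: (scalerI lp); rewrite scaler0 -[RHS]px.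
  rewrite /act scaler_sumr; apply: eq_bigr => i _.
  by rewrite [in RHS]rE coefZ scalerA.
elim: r {rE} => [/eqP|z r IH /=]; first by rewrite (negPf x0).
have [/IH //|rx /eqP] := eqVneq (factors r x) 0.
rewrite subr_eq0 => /eqP Lz; exists (factors r x); split=> //; last by exists z.
by elim: (r) => //= w t Et; apply: subspaceB => //; [exact: EL|exact: subspaceZ].
Qed.

End Eigenvector.

(** * Gradings and graded duals *)

Lemma finite_suppP (W : zmodType) (J : choiceType) (f : J -> W) :
  finite_set [set j | f j != 0] <->
  exists2 s : seq J, uniq s & forall j, j \notin s -> f j = 0.
Proof.
split=> [/finite_seqP [s sE]|[s _ sP]].
  exists (undup s); first exact: undup_uniq.
  move=> j; rewrite mem_undup => /negP js; apply/eqP/negPn/negP => fj.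
  by apply: js; have : [set j | f j != 0] j by []; rewrite sE.
apply: (@sub_finite_set _ _ [set` s]); last exact: finite_seq.
by move=> j /= fj; apply/negPn/negP => /sP /eqP; rewrite (negPf fj).
Qed.

Section Grading.
Variables (F : fieldType) (V : lmodType F) (J : choiceType) (gr : J -> set V).

(** The homogeneous projections carry the same information as a direct sum
    decomposition, without finitely supported sums over J. *)
Record grading_proj (pr : J -> V -> V) : Prop := GradingProj {
  gp_lin : forall j, linear (pr j);
  gp_in : forall j x, gr j (pr j x);
  gp_id : forall j x, gr j x -> pr j x = x;
  gp_neq : forall i j x, gr i x -> j != i -> pr j x = 0;
  gp_sum : forall x, exists s : seq J, [/\ uniq s,
    forall j, j \notin s -> pr j x = 0 & x = \sum_(j <- s) pr j x]
}.

Lemma direct_sum_proj : direct_sum gr -> exists pr, grading_proj pr.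
Proof.
move=> [Sgr dgr]; pose pr j x := projT1 (cid (dgr x)) j.
have prP x : [/\ forall j, gr j (pr j x), finite_set [set j | pr j x != 0]
    & x = \sum_(j \in [set: J]) pr j x] by exact: (projT2 (cid (dgr x))).1.
have prU x f : (forall j, gr j (f j)) ->
    (exists2 s : seq J, uniq s & forall j, j \notin s -> f j = 0) ->
    x = \sum_(j \in [set: J]) f j -> forall j, pr j x = f j.
  move=> fg /finite_suppP ff xf j; have [_ U] := projT2 (cid (dgr x)).
  by rewrite /pr (U f).
have prS x : exists s : seq J, [/\ uniq s,
    forall j, j \notin s -> pr j x = 0 & x = \sum_(j <- s) pr j x].
  have [_ /finite_suppP [s us s0] xE] := prP x.
  by exists s; split=> //; rewrite {1}xE (fsum_seq us).
have pr1 i x : gr i x -> forall j, pr j x = if j == i then x else 0.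
  move=> gx; apply: prU.
  - by move=> j; case: eqP => [-> //|_]; exact: (Sgr j).1.
  - by exists [:: i] => // j; rewrite inE => /negPf ->.
  - rewrite (@fsum_seq _ _ _ [:: i]) ?big_seq1 ?eqxx // => j.
    by rewrite inE => /negPf ->.
exists pr; split=> //.
- move=> j a x y; move: j; have [sx [ux x0 xE]] := prS x.
  have [sy [uy y0 yE]] := prS y.
  have s0 j : j \notin undup (sx ++ sy) -> a *: pr j x + pr j y = 0.
    rewrite mem_undup mem_cat negb_or => /andP [jx jy].
    by rewrite x0 // y0 // scaler0 addr0.
  apply: (prU _ (fun j => a *: pr j x + pr j y)).
  + by move=> j; apply: (Sgr j).2; have [] := prP x; have [] := prP y.
  + by exists (undup (sx ++ sy)); rewrite ?undup_uniq.
  + rewrite (fsum_seq _ s0) ?undup_uniq // big_split -scaler_sumr /=.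
    have widen z : (forall j, j \notin undup (sx ++ sy) -> pr j z = 0) ->
        \sum_(j <- undup (sx ++ sy)) pr j z = z.
      move=> z0; have [_ _ {2}->] := prP z.
      by rewrite (fsum_seq _ z0) ?undup_uniq.
    by rewrite !widen // => j; rewrite mem_undup mem_cat negb_or => /andP [? ?];
      [apply: y0|apply: x0].
- by move=> j x; have [] := prP x.
- by move=> j x gx; rewrite (pr1 _ _ gx) eqxx.
- by move=> i j x gx ji; rewrite (pr1 _ _ gx) (negPf ji).
Qed.

Section Proj.
Variables (pr : J -> V -> V) (prP : grading_proj pr).

Lemma proj_direct_sum : (forall j, subspace (gr j)) -> direct_sum gr.
Proof.
move=> Sgr; split=> // x; have [s [us s0 xE]] := gp_sum prP x.
exists (pr^~ x); split.
  split=> [j||]; first exact: (gp_in prP).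
    by apply/finite_suppP; exists s.
  by rewrite (fsum_seq us).
move=> f [fg ff xf]; apply/funext => j.
rewrite xf (lin_fsum (gp_lin prP j)) // (@fsum_seq _ _ _ [:: j]) //.
  by rewrite big_seq1 (gp_id prP).
move=> i; rewrite inE => ij; apply: (gp_neq prP (fg i)).
by rewrite eq_sym.
Qed.

Lemma proj_widen x (s : seq J) : uniq s ->
  (forall j, j \notin s -> pr j x = 0) -> x = \sum_(j <- s) pr j x.
Proof.
move=> us s0; have [t [ut t0 xE]] := gp_sum prP x.
by rewrite {1}xE -(fsum_seq ut t0) (fsum_seq us s0).
Qed.

Lemma proj_eq0 x : (forall j, pr j x = 0) -> x = 0.
Proof. by move=> x0; rewrite (@proj_widen x [::]) // big_nil. Qed.

Lemma grading_ext (W : zmodType) (s : GRing.Scale.law F W) (f g : V -> W) :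
  linear_for s f -> linear_for s g ->
  (forall j x, gr j x -> f x = g x) -> f =1 g.
Proof.
move=> lf lg fg x; have [t [_ _ ->]] := gp_sum prP x.
rewrite (lin_sum lf) (lin_sum lg); apply: eq_bigr => j _.
by apply: fg; exact: (gp_in prP).
Qed.

Lemma grading_subspace j : subspace (gr j).
Proof.
have gr0 : gr j 0 by rewrite -(lin0 (gp_lin prP j)); exact: (gp_in prP).
split=> // a x y gx gy.
by rewrite -(gp_id prP gx) -(gp_id prP gy) -(gp_lin prP j); exact: (gp_in prP).
Qed.

End Proj.

Lemma gdual_predP (f : V -> F) : (f : V -> F^o) \in gdual_pred gr <->
  scalar f /\ exists s : seq J, forall j x, j \notin s -> gr j x -> f x = 0.
Proof. by split=> [/asboolP|H]; last exact/asboolP. Qed.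

Lemma gdual_functional_space :
  functional_space [set f : V -> F | (f : V -> F^o) \in gdual_pred gr].
Proof.
split=> [u /gdual_predP [] //|a u u' Au Au'].
exact: (gdual_submod gr).2 Au Au'.
Qed.

Lemma proj_functional (pr : J -> V -> V) (u : V -> F) j : grading_proj pr ->
  scalar_on (gr j) u -> (fun x => u (pr j x) : F^o) \in gdual_pred gr.
Proof.
move=> prP lu; have u0 : u 0 = 0.
  have g0 := (grading_subspace prP j).1.
  have := lu (-1) 0 0 g0 g0; rewrite scaler0 addr0 mulN1r => /eqP.
  by rewrite addNr => /eqP.
apply/gdual_predP; split.
  by move=> a x y; rewrite (gp_lin prP) lu //; exact: (gp_in prP).
exists [:: j] => i x; rewrite inE => ij gx.
by rewrite (gp_neq prP gx) // eq_sym.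
Qed.

(** A nonzero vector has a nonzero homogeneous component, and a functional on
    that finite-dimensional component extends by zero to the other ones. *)
Lemma gdual_separating : direct_sum gr -> (forall j, fin_dim (gr j)) ->
  separating [set f : V -> F | (f : V -> F^o) \in gdual_pred gr].
Proof.
move=> /direct_sum_proj [pr prP] fd x x0; apply: (proj_eq0 prP) => j.
apply/eqP/negPn/negP => xj.
have [u lu] := fin_dim_functional (grading_subspace prP j) (fd j)
  (gp_in prP j x) xj.
by case/eqP; exact: (x0 _ (proj_functional prP lu)).
Qed.

End Grading.

Section Weights.
Variables (R : realType) (V : lmodType R[i]) (J : choiceType).
Variables (gr : J -> set V) (pr : J -> V -> V) (prP : grading_proj gr pr).
Variables (L : V -> V) (wt : J -> R[i]).
Hypotheses (lL : linear L) (Lwt : forall j x, gr j x -> L x = wt j *: x).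

(** L acts on the j-th component of x both by l and by wt j. *)
Lemma weight_proj l x j : L x = l *: x -> pr j x = 0 \/ l = wt j.
Proof.
move=> Lx; have : pr j (L x) = wt j *: pr j x.
  rewrite -Lwt; last exact: (gp_in prP).
  move: x {Lx}; apply: (@grading_ext _ _ _ _ _ prP _ *:%R (fun x => pr j (L x))
    (fun x => L (pr j x))).
  - exact: linear_comp lL (gp_lin prP j).
  - exact: linear_comp (gp_lin prP j) lL.
  move=> i x gx; rewrite (Lwt gx) (linZ (gp_lin prP j)) /=.
  have [->|ij] := eqVneq j i; first by rewrite !(gp_id prP gx) (Lwt gx).
  by rewrite (gp_neq prP gx ij) scaler0 (lin0 lL).
rewrite Lx (linZ (gp_lin prP j)) /= => /eqP.
rewrite -subr_eq0 -scalerBl scaler_eq0 subr_eq0 => /orP [] /eqP; by [right|left].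
Qed.

Hypothesis wt_large : forall B : R, exists s : seq J,
  forall j x, j \notin s -> gr j x -> x != 0 -> (B < complex.Re (wt j))%R.

(** Membership in the graded dual depends on the weights only: it amounts to
    vanishing on the vectors of large weight.  This makes the graded dual
    invariant under isomorphisms that do not respect the gradings. *)
Lemma gdual_weightP (f : V -> R[i]) : (f : V -> R[i]^o) \in gdual_pred gr <->
  scalar f /\ exists B : R, forall l x, (B < complex.Re l)%R -> L x = l *: x ->
    f x = 0.
Proof.
rewrite gdual_predP; split=> -[lf].
  move=> [s s0]; split=> //; exists (\big[Num.max/0]_(j <- s) complex.Re (wt j)).
  move=> l x ltl Lx; have [t [ut t0 ->]] := gp_sum prP x.
  rewrite (lin_sum lf) big1 // => j _.
  have [js|js] := boolP (j \in s); last exact: s0 js (gp_in prP j x).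
  have [->|lj] := weight_proj j Lx; first exact: (lin0 lf).
  suff : (complex.Re (wt j) <= \big[Num.max/0]_(j <- s) complex.Re (wt j))%R.
    by rewrite leNgt -lj ltl.
  exact: (@le_bigmax_seq _ R J s 0 j xpredT (fun j => complex.Re (wt j))) js isT.
move=> [B fB]; split=> //; have [s sB] := wt_large B; exists s => j x js gx.
have [->|x0] := eqVneq x 0; first exact: (lin0 lf).
exact: fB (sB j x js gx x0) (Lwt gx).
Qed.

End Weights.

(** * Transposing the Jacobi identity *)

Definition eventually0 (W : zmodType) (E : nat -> W) : Prop :=
  exists N, forall i, (N <= i)%N -> E i = 0.

Lemma eventually0_finite (W W' : zmodType) (E : nat -> W) (E' : nat -> W') :
  eventually0 E -> (forall i, E i = 0 -> E' i = 0) ->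
  finite_set [set i | E' i != 0].
Proof.
move=> [N EN] EE'; apply/finite_suppP; exists (iota 0 N).
  exact: iota_uniq.
by move=> i; rewrite mem_iota /= add0n -leqNgt => /EN /EE'.
Qed.

Section JacobiDuality.
Variables (C : fieldType) (E : pzRingType) (V M1 M2 M3 : lmodType C).
Variables (D1 : int -> M1 -> tensor V M1) (D2 : int -> M2 -> tensor V M2).
Variables (D3 : int -> M3 -> tensor V M3) (W : E -> M3 -> tensor M1 M2).
Hypotheses (lD1 : forall k, linear (D1 k)) (lD2 : forall k, linear (D2 k)).
Hypothesis lW : forall t, linear (W t).

(** The co-Jacobi identity evaluated at the functional u ⊗ (f ⊗ g).  Read with
    u, f, g as module elements it is the Jacobi identity of the transposed
    operators, evaluated at x. *)
Definition jacobi_at (l m : int) (t : E) (u : V -> C) (f : M1 -> C)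
    (g : M2 -> C) (x : M3) : Prop :=
  \sum_(i \in [set: nat]) ((-1) ^+ i * binz C l i) *
      tform u (fun y => tform f g (W (t + i%:R) y)) (D3 (m + l - i%:Z) x)
  - \sum_(i \in [set: nat]) ((-1) ^ l * (-1) ^+ i * binz C l i) *
      tform f (fun y => tform u g (D2 (m + i%:Z) y)) (W (t + l%:~R - i%:R) x)
  = \sum_(i \in [set: nat]) binz C m i *
      tform (fun y => tform u f (D1 (l + i%:Z) y)) g (W (t + m%:~R - i%:R) x).

Section CoJacobi.
Hypothesis D3_trunc : forall m x, eventually0 (fun i => D3 (m - i%:Z) x).
Hypothesis W_trunc : forall t x, eventually0 (fun i => W (t - i%:R) x).

(** Functionals u ⊗ (f ⊗ g) separate iterated tensors, and truncation makes the
    sums finite, so that functionals can be moved inside them. *)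
Lemma co_jacobi_at (A : set (V -> C)) (B1 : set (M1 -> C)) (B2 : set (M2 -> C)) :
  functional_space A -> separating A -> functional_space B1 -> separating B1 ->
  functional_space B2 -> separating B2 ->
  co_jacobi D1 D2 D3 W <-> forall l m t u f g x, A u -> B1 f -> B2 g ->
    jacobi_at l m t u f g x.
Proof.
move=> fA sA fB1 sB1 fB2 sB2.
have lid (U : lmodType C) : linear (@id U) by [].
have evalE l m t u f g x : scalar u -> scalar f -> scalar g ->
  jacobi_at l m t u f g x <-> tform u (tform f g) (
    \sum_(i \in [set: nat]) ((-1) ^+ i * binz C l i) *:
        tmap id (W (t + i%:R)) (D3 (m + l - i%:Z) x)
  - \sum_(i \in [set: nat]) ((-1) ^ l * (-1) ^+ i * binz C l i) *:
        tswap (tmap id (D2 (m + i%:Z)) (W (t + l%:~R - i%:R) x))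
  - \sum_(i \in [set: nat]) binz C m i *:
        tassoc (tmap (D1 (l + i%:Z)) id (W (t + m%:~R - i%:R) x))) = 0.
  move=> lu lf lg; have lfg := tform_scalar lf lg.
  have lug := tform_scalar lu lg; have luf := tform_scalar lu lf.
  have lufg := tform_scalar lu lfg; rewrite !(linB lufg).
  rewrite !(lin_fsum lufg); last 3 first.
  - apply: (eventually0_finite (W_trunc (t + m%:~R) x)) => i ->.
    rewrite (lin0 (tmap_linear (lD1 _) (lid M2))).
    by rewrite (lin0 (@tassoc_linear _ V M1 M2)) scaler0.
  - apply: (eventually0_finite (W_trunc (t + l%:~R) x)) => i ->.
    rewrite (lin0 (tmap_linear (lid M1) (lD2 _))).
    by rewrite (lin0 (@tswap_linear _ M1 V M2)) scaler0.
  - apply: (eventually0_finite (D3_trunc (m + l) x)) => i ->.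
    by rewrite (lin0 (tmap_linear (lid V) (lW _))) scaler0.
  under eq_fsbigr => i _ do rewrite (linZ lufg) /= tform_map //.
  under [X in _ - X - _]eq_fsbigr => i _.
    rewrite (linZ lufg) /= tform_swap // tform_map //; over.
  under [X in _ - _ - X]eq_fsbigr => i _.
    rewrite (linZ lufg) /= tform_assoc // tform_map //; over.
  rewrite /jacobi_at; split=> [->|/eqP]; first by rewrite subrr.
  by rewrite subr_eq0 => /eqP.
split=> [jac l m t u f g x Au Bf Bg|jac l m t x].
  apply/evalE; [exact: fA.1|exact: fB1.1|exact: fB2.1|].
  rewrite jac subrr; apply: (lin0 (tform_scalar _ (tform_scalar _ _))).
  - exact: fA.1.
  - exact: fB1.1.
  - exact: fB2.1.
apply/eqP; rewrite -subr_eq0; apply/eqP.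
pose B := [set h : tensor M1 M2 -> C | scalar h /\ forall y,
  (forall f g, B1 f -> B2 g -> tform f g y = 0) -> h y = 0].
apply: (tensor_separated fA sA (B := B)).
- split=> [h [] //|a h h' [lh hB] [lh' hB']]; split; last first.
    by move=> y y0; rewrite hB // hB' // mulr0 addr0.
  by move=> b y z; rewrite lh lh' /= !mulrDr addrACA mulrCA.
- move=> y y0; apply: (tensor_separated fB1 sB1 fB2 sB2) => f g Bf Bg.
  apply: y0; split; first by apply: tform_scalar; [exact: fB1.1|exact: fB2.1].
  by move=> z; exact.
move=> u h Au [lh hB].
rewrite -tforml_form //; last exact: fA.1.
apply: hB => f g Bf Bg; have lf := fB1.1 _ Bf; have lg := fB2.1 _ Bg.
have lu := fA.1 _ Au; rewrite tforml_form //; last exact: tform_scalar.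
by apply/evalE => //; exact: jac.
Qed.

End CoJacobi.

Section Jacobi.
Variables (A N1 N2 N3 : lmodType C).
Variables (Y1 : int -> A -> N1 -> N1) (Y2 : int -> A -> N2 -> N2).
Variables (Y3 : int -> A -> N3 -> N3) (Z : E -> N1 -> N2 -> N3).
Variables (evA : A -> V -> C) (ev1 : N1 -> M1 -> C).
Variables (ev2 : N2 -> M2 -> C) (ev3 : N3 -> M3 -> C).
Hypothesis ev3_lin : forall x, scalar (ev3^~ x).
Hypothesis ev3_inj : injective ev3.
Hypothesis Y1E : forall k u n,
  ev1 (Y1 k u n) = fun x => tform (evA u) (ev1 n) (D1 k x).
Hypothesis Y2E : forall k u n,
  ev2 (Y2 k u n) = fun x => tform (evA u) (ev2 n) (D2 k x).
Hypothesis Y3E : forall k u n,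
  ev3 (Y3 k u n) = fun x => tform (evA u) (ev3 n) (D3 k x).
Hypothesis ZE : forall t n p,
  ev3 (Z t n p) = fun x => tform (ev1 n) (ev2 p) (W t x).
Hypothesis Y3_0 : forall k u, Y3 k u 0 = 0.
Hypotheses (Z0l : forall t p, Z t 0 p = 0) (Z0r : forall t n, Z t n 0 = 0).
Hypothesis Y1_trunc : forall k u n, eventually0 (fun i => Y1 (k + i%:Z) u n).
Hypothesis Y2_trunc : forall k u n, eventually0 (fun i => Y2 (k + i%:Z) u n).
Hypothesis Z_trunc : forall t n p, eventually0 (fun i => Z (t + i%:R) n p).

(** Each term of the Jacobi identity, evaluated at x, is by definition of the
    transposed operators the corresponding term of [jacobi_at]. *)
Lemma transpose_jacobi : jacobi Y1 Y2 Y3 Z <-> forall l m t u n p x,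
  jacobi_at l m t (evA u) (ev1 n) (ev2 p) x.
Proof.
have evalE l m t u n p x : jacobi_at l m t (evA u) (ev1 n) (ev2 p) x <-> ev3 (
    \sum_(i \in [set: nat]) ((-1) ^+ i * binz C l i) *:
        Y3 (m + l - i%:Z) u (Z (t + i%:R) n p)
  - \sum_(i \in [set: nat]) ((-1) ^ l * (-1) ^+ i * binz C l i) *:
        Z (t + l%:~R - i%:R) n (Y2 (m + i%:Z) u p)
  - \sum_(i \in [set: nat]) binz C m i *:
        Z (t + m%:~R - i%:R) (Y1 (l + i%:Z) u n) p) x = 0.
  rewrite !(linB (ev3_lin x)) !(lin_fsum (ev3_lin x)); last 3 first.
  - apply: (eventually0_finite (Y1_trunc l u n)) => i ->.
    by rewrite Z0l scaler0.
  - apply: (eventually0_finite (Y2_trunc m u p)) => i ->.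
    by rewrite Z0r scaler0.
  - apply: (eventually0_finite (Z_trunc t n p)) => i ->.
    by rewrite Y3_0 scaler0.
  under eq_fsbigr => i _ do rewrite (linZ (ev3_lin x)) /= Y3E ZE.
  under [X in _ - X - _]eq_fsbigr => i _.
    rewrite (linZ (ev3_lin x)) /= ZE Y2E; over.
  under [X in _ - _ - X]eq_fsbigr => i _.
    rewrite (linZ (ev3_lin x)) /= ZE Y1E; over.
  rewrite /jacobi_at; split=> [->|/eqP]; first by rewrite subrr.
  by rewrite subr_eq0 => /eqP.
split=> [jac l m t u n p x|jac l m t u n p].
  by apply/evalE; rewrite jac subrr (lin0 (ev3_lin x)).
apply/eqP; rewrite -subr_eq0; apply/eqP/ev3_inj/funext => x.
by rewrite (lin0 (ev3_lin x)); exact/evalE.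
Qed.

End Jacobi.

Lemma binz0 i : binz C 0 i = (i == 0%N)%:R.
Proof.
rewrite /binz; case: i => [|i]; first by rewrite big_ord0 fact0 divr1.
by rewrite big_ord_recl subrr mul0r mul0r.
Qed.

Lemma binz1 i : binz C 1 i = (i < 2)%N%:R.
Proof.
rewrite /binz; case: i => [|[|i]]; first by rewrite big_ord0 fact0 divr1.
  by rewrite big_ord1 subr0 divr1.
by rewrite !big_ord_recl subrr mul0r mulr0 mul0r.
Qed.

(** The case l = 0, m = 1 of the Jacobi identity: for u the conformal vector it
    computes the commutator with L(0). *)
Lemma jacobi_at01 t u f g x : jacobi_at 0 1 t u f g x ->
  tform u (fun y => tform f g (W t y)) (D3 1 x) =
  tform f (fun y => tform u g (D2 1 y)) (W t x)
  + tform (fun y => tform u f (D1 0 y)) g (W (t + 1) x)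
  + tform (fun y => tform u f (D1 1 y)) g (W t x).
Proof.
rewrite /jacobi_at.
rewrite (@fsum_seq _ _ _ [:: 0%N]) //; last first.
  by move=> i; rewrite inE => /negPf i0; rewrite binz0 i0 mulr0 mul0r.
rewrite (@fsum_seq _ _ _ [:: 0%N]) //; last first.
  by move=> i; rewrite inE => /negPf i0; rewrite binz0 i0 mulr0 mul0r.
rewrite (@fsum_seq _ _ _ [:: 0; 1]%N) //; last first.
  by move=> [|[|i]] // _; rewrite binz1 mul0r.
rewrite !big_cons !big_nil !binz0 !binz1 /= !expr0 expr0z !mulr1 !mul1r !addr0.
rewrite !subr0 add0r (addrK 1 t) => /eqP; rewrite subr_eq => /eqP ->.
by rewrite addrC addrA.
Qed.

End JacobiDuality.

(** * Graded tensors and the action of L(0) *)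

Section TensorGradings.
Variables (F : fieldType) (V W : lmodType F) (grV : int -> set V).

(** The two cases of the match are needed because W is graded by natural numbers:
    a negative degree n - r forces the contraction to vanish. *)
Lemma tforml_gr (grW : nat -> set W) (n r : int) (u : V -> F) y :
  (forall s, subspace (grW s)) -> scalar u ->
  (forall i v, i != r -> grV i v -> u v = 0) ->
  tensor_gr Posz grV grW n y ->
  match n - r with Posz s => grW s (tforml u y) | Negz _ => tforml u y = 0 end.
Proof.
move=> Sgr lu u0; pose T : set W := fun z =>
  match n - r with Posz s => grW s z | Negz _ => z = 0 end.
rewrite -/(T (tforml u y)); have [T0 Tl] : subspace T.
  rewrite /T; case: (n - r) => s; first exact: Sgr.
  by split=> // a x z -> ->; rewrite scaler0 addr0.
have lT := tforml_linear (W := W) lu; move: y; apply: span_min.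
  split=> [|a x z Tx Tz]; first by rewrite /= (lin0 lT).
  by rewrite /= lT; exact: Tl.
move=> _ /= [i [s [v [w [isn gv gw ->]]]]]; rewrite tforml_tens //.
have [ir|ir] := eqVneq i r; last by rewrite (u0 i) // scale0r.
have Tw : T w by rewrite /T -isn ir addrC addKr.
by have := Tl (u v) w 0 Tw T0; rewrite addr0.
Qed.

Lemma tform_gr0 (J : Type) (emb : J -> int) (grW : J -> set W) (n : int)
    (u : V -> F) (f : W -> F) y :
  scalar u -> scalar f ->
  (forall r s v w, r + emb s = n -> grV r v -> grW s w -> u v * f w = 0) ->
  tensor_gr emb grV grW n y -> tform u f y = 0.
Proof.
move=> lu lf uf0; have lt := tform_scalar lu lf; move: y.
apply: (@span_min _ _ _ [set y | tform u f y = 0]).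
  split=> [|a x z /= x0 z0]; first exact: (lin0 lt).
  by rewrite lt x0 z0 mulr0 addr0.
by move=> _ /= [r [s [v [w [rsn gv gw ->]]]]]; rewrite tform_tens // (uf0 r s).
Qed.

Lemma tforml_sum I (r : seq I) (u : I -> V -> F) (y : tensor V W) :
  tforml (fun v => \sum_(i <- r) u i v) y = \sum_(i <- r) tforml (u i) y.
Proof.
rewrite /tforml /tlift /tsum exchange_big; apply: eq_bigr => p _ /=.
by rewrite scaler_suml.
Qed.

End TensorGradings.

Lemma gdual_sum (F : fieldType) (V : lmodType F) (J : choiceType)
    (gr : J -> set V) (pr : J -> V -> V) (u : V -> F) :
  grading_proj gr pr -> (u : V -> F^o) \in gdual_pred gr ->
  exists2 s : seq J, uniq s & u = fun x => \sum_(j <- s) u (pr j x).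
Proof.
move=> prP /gdual_predP [lu [s s0]]; exists (undup s); first exact: undup_uniq.
apply/funext; apply: (grading_ext prP lu
  (g := fun x => \sum_(j <- undup s) u (pr j x))).
  move=> a x y; rewrite /= mulr_sumr -big_split; apply: eq_bigr => j _ /=.
  by rewrite (gp_lin prP) lu.
move=> j x gx; have [js|js] := boolP (j \in s).
  rewrite (bigD1_seq j) ?mem_undup ?undup_uniq //= (gp_id prP gx) big1 ?addr0 //.
  by move=> i ij; rewrite (gp_neq prP gx ij) (lin0 lu).
rewrite (s0 j) // big_seq big1 // => i; rewrite mem_undup => is_.
rewrite (gp_neq prP gx) ?(lin0 lu) //.
by apply: contraNneq js => <-.
Qed.

Lemma trunc_eventually0 (W : zmodType) (D : int -> W) (m : int) :
  (exists k0 : int, forall k, (k < k0)%R -> D k = 0) ->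
  eventually0 (fun i => D (m - i%:Z)).
Proof.
move=> [k0 H]; exists `|m - k0|.+1 => i mi; apply: H.
rewrite ltrBlDr -ltrBlDl; apply: (le_lt_trans (ler_norm _)).
by rewrite -abszE ltz_nat.
Qed.

Section Separation.
Variables (R : realType) (V : lmodType R[i]).

Definition separated : Prop := separating [set f : V -> R[i] | scalar f].

Lemma scalar_functional_space : functional_space [set f : V -> R[i] | scalar f].
Proof.
split=> // a u u' lu lu' b x y; rewrite lu lu' /= !mulrDr addrACA.
by congr (_ + _ + _); rewrite mulrCA.
Qed.

Lemma gdual_separated (J : choiceType) (gr : J -> set V) :
  direct_sum gr -> (forall j, fin_dim (gr j)) -> separated.
Proof.
move=> ds fd x x0; apply: (gdual_separating ds fd) => u /gdual_predP [lu _].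
exact: x0.
Qed.

End Separation.

Section Structure.
Variables (R : realType) (V : voc_data R).

Lemma delta_linear (M : comod_data V) k : linear (cm_delta M k).
Proof. exact: linearP. Qed.

Lemma rho_scalar : scalar (voc_rho V).
Proof. exact: linearP. Qed.

Lemma c_scalar : scalar (voc_c V).
Proof. exact: linearP. Qed.

Lemma cm_L_linear (M : comod_data V) k : linear (@cm_L R V M k).
Proof.
by move=> a x y; rewrite /cm_L linearP (tforml_linear rho_scalar).
Qed.

Lemma rho_cm_L (M : comod_data V) (g : M -> R[i]) k j : scalar g -> k = 1 - j ->
  (fun x => tform (voc_rho V) g (cm_delta M k x)) = fun x => g (cm_L j x).
Proof.
by move=> lg ->; apply/funext => x; rewrite /cm_L tforml_form //; exact: rho_scalar.
Qed.

End Structure.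

Section Commutator.
Variables (R : realType) (V : voc_data R) (E : pzRingType).
Variables (M1 M2 M3 : comod_data V) (W : E -> M3 -> tensor M1 M2).
Hypotheses (sepV : separated V) (sep1 : separated M1) (sep2 : separated M2).
Hypothesis lW : forall t, linear (W t).
Hypothesis D3_trunc : forall x : M3,
  exists k0 : int, forall k, (k < k0)%R -> cm_delta M3 k x = 0.
Hypothesis W_trunc : forall t x, eventually0 (fun i => W (t - i%:R) x).
Hypothesis W_jacobi : co_jacobi (cm_delta M1) (cm_delta M2) (cm_delta M3) W.

(** The term with L(1) in [jacobi_at01] is a scalar multiple of W_t by the
    derivative property, so each W_t intertwines L(0) with L(0) ⊗ 1 + 1 ⊗ L(0)
    up to a scalar. *)
Lemma L0_commutator a t f g x : scalar f -> scalar g ->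
  tmap (@cm_L R V M1 1) id (W (t + 1) x) = a *: W t x ->
  tform f g (W t (cm_L 0 x)) =
    tform f (fun y => g (cm_L 0 y)) (W t x)
    + tform (fun y => f (cm_L 0 y)) g (W t x) + a * tform f g (W t x).
Proof.
move=> lf lg dW; have lfg := tform_scalar lf lg.
have /jacobi_at01 : jacobi_at (cm_delta M1) (cm_delta M2) (cm_delta M3) W
    0 1 t (voc_rho V) f g x.
  have D3_t m y : eventually0 (fun i => cm_delta M3 (m - i%:Z) y).
    exact: (@trunc_eventually0 _ (fun k => cm_delta M3 k y)).
  have [+ _] := (co_jacobi_at
    (D3 := fun k => cm_delta M3 k) (@delta_linear _ _ M1) (@delta_linear _ _ M2)
    lW D3_t W_trunc (scalar_functional_space V) sepV (scalar_functional_space M1)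
    sep1 (scalar_functional_space M2) sep2); move=> /(_ W_jacobi); apply=> //.
  exact: rho_scalar.
rewrite (rho_cm_L (k := 1) (j := 0) lg) // (rho_cm_L (k := 1) (j := 0) lf) //.
rewrite (rho_cm_L (k := 0) (j := 1) lf) //.
have -> : tform (voc_rho V) (fun y => tform f g (W t y)) (cm_delta M3 1 x) =
    tform f g (W t (cm_L 0 x)).
  rewrite -(tforml_form (g := fun y => tform f g (W t y))) //.
    exact: rho_scalar.
  exact: scalar_comp (lW t) lfg.
move=> ->; rewrite addrAC; congr (_ + _ + _).
have -> : tform (fun y => f (cm_L 1 y)) g (W (t + 1) x) =
    tform f g (tmap (@cm_L R V M1 1) id (W (t + 1) x)).
  by rewrite tform_map //; exact: cm_L_linear.
by rewrite dW (linZ lfg).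
Qed.

End Commutator.

Section Voc.
Variables (R : realType) (V : voc_data R) (V_voc : is_voc V).
Hypothesis rho_wt2 : forall s v, voc_gr V s v -> s != 2 -> voc_rho V v = 0.

Lemma voc_separated : separated V.
Proof. exact: gdual_separated (voc_grading V_voc) (voc_fin_dim V_voc). Qed.

Lemma rho_gdual : (voc_rho V : V -> R[i]^o) \in gdual_pred (voc_gr V).
Proof.
apply/gdual_predP; split; first exact: rho_scalar.
by exists [:: 2] => s v; rewrite inE => s2 gv; exact: rho_wt2 gv s2.
Qed.

(** By cocreation, c (L(0) v) = (ρ ⊗ c) Δ_1 v = 0, so the counit only lives in
    weight zero. *)
Lemma c_gdual : (voc_c V : V -> R[i]^o) \in gdual_pred (voc_gr V).
Proof.
apply/gdual_predP; split; first exact: c_scalar.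
exists [:: 0] => s v; rewrite inE => s0 gv; apply/eqP.
have : voc_c V (voc_L 0 v) = 0.
  rewrite /voc_L subr0 tforml_form; [|exact: rho_scalar|exact: c_scalar].
  rewrite -tformr_form; [|exact: rho_scalar|exact: c_scalar].
  by rewrite (voc_cocreation V_voc v).2 // (lin0 (@rho_scalar R V)).
move: gv; rewrite (voc_L0 V_voc) /= => ->; rewrite (linZ (@c_scalar R V)) /=.
by move=> /eqP; rewrite mulf_eq0 intr_eq0 (negPf s0).
Qed.

Lemma voc_lowP s : (s < voc_low V)%R -> voc_gr V s = [set 0].
Proof.
have [s0 s0P] := voc_lower V_voc; move: s.
exact: (@xgetPex _ 0 [set s0 | forall s, (s < s0)%R -> voc_gr V s = [set 0]]
  (ex_intro _ s0 s0P)).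
Qed.

Lemma voc_gr_nat i v : voc_gr V i v -> v = 0 \/ exists t : nat, i = voc_low V + t%:Z.
Proof.
have [/voc_lowP ->|] := ltP i (voc_low V); first by left.
rewrite -subr_ge0 => le gv; right; exists `|i - voc_low V|%N.
by rewrite gez0_abs // (addrC (voc_low V)) subrK.
Qed.

Lemma voc_comodule_proj : exists pr, grading_proj (cm_gr (voc_comodule V)) pr.
Proof.
have [pr prP] := direct_sum_proj (voc_grading V_voc).
exists (fun t => pr (voc_low V + t%:Z)); split.
- by move=> t; exact: (gp_lin prP).
- by move=> t x; exact: (gp_in prP).
- by move=> t x; exact: (gp_id prP).
- move=> s t x gx ts; apply: (gp_neq prP gx).
  by rewrite (inj_eq (addrI _)).
move=> x; have [s [us s0 xE]] := gp_sum prP x.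
have prN i : i \notin [seq voc_low V + t%:Z | t <- [seq `|j - voc_low V|%N | j <- s]]
    -> pr i x = 0.
  move=> iN; have [i_s|] := boolP (i \in s); last exact: s0.
  have [//|[t it]] := voc_gr_nat (gp_in prP i x).
  case/negP: iN; apply/mapP; exists `|i - voc_low V|%N; last first.
    by rewrite it (addrC _ t%:Z) addrK [LHS]addrC.
  by apply/mapP; exists i.
exists (undup [seq `|j - voc_low V|%N | j <- s]); split.
- exact: undup_uniq.
- move=> t; rewrite mem_undup => ts; apply: prN; apply: contra ts.
  move=> /mapP [t' t's /addrI [->]]; exact: t's.
rewrite -(big_map (fun t => voc_low V + t%:Z) xpredT (fun i => pr i x)).
apply: (proj_widen prP).
  by rewrite map_inj_uniq ?undup_uniq // => a b /addrI [].
move=> i iN; apply: prN; apply: contra iN => /mapP [t' t's ->].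
by apply: map_f; rewrite mem_undup.
Qed.

Lemma voc_comodule_admissible : admissible_comodule (voc_comodule V).
Proof.
have [pr prP] := voc_comodule_proj.
split.
- apply: (proj_direct_sum prP) => t; exact: (grading_subspace prP t).
- exact: (voc_trunc V_voc).
- exact: (voc_counit V_voc).
- exact: (voc_jacobi V_voc).
- exact: (voc_virasoro V_voc).
- exact: (voc_derivative V_voc).
move=> t k x gx; have := voc_delta_gr V_voc k gx.
apply: span_min; first exact: span_subspace.
move=> _ [r [s [v [w [rs gv gw ->]]]]]; apply: mem_span => /=.
have [w0|[t' st']] := voc_gr_nat gw.
  exists (t%:Z + k + 1), 0%N, 0, 0; split; first by rewrite addr0.
  - exact: ((voc_grading V_voc).1 _).1.
  - exact: (grading_subspace prP 0%N).1.
  by rewrite w0 !tens0.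
exists r, t', v, w; split=> //; last by rewrite /= -st'.
by apply: (addrI (voc_low V)); rewrite addrCA -st' rs !addrA.
Qed.

Lemma voc_comodule_weight t (x : voc_comodule V) : cm_gr (voc_comodule V) t x ->
  cm_L 0 x = ((voc_low V)%:~R + t%:R) *: x.
Proof.
move=> /=; rewrite (voc_L0 V_voc) /= => Lx.
by rewrite [LHS]Lx rmorphD.
Qed.

End Voc.

(** * L(0)-weights of simple comodules *)

Definition weight_graded (R : realType) (V : voc_data R) (M : comod_data V)
    (h : R[i]) : Prop :=
  forall t x, cm_gr M t x -> cm_L 0 x = (h + t%:R) *: x.

Section Schur.
Variables (R : realType) (V : voc_data R) (V_voc : is_voc V).
Hypothesis rho_wt2 : forall s v, voc_gr V s v -> s != 2 -> voc_rho V v = 0.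
Variables (M : comod_data V) (M_adm : admissible_comodule M).
Hypothesis M_fin : forall t, fin_dim (cm_gr M t).

Lemma comodule_separated : separated M.
Proof. exact: gdual_separated (cm_grading M_adm) M_fin. Qed.

Lemma coaction_L0 k (u : V -> R[i]) (g : M -> R[i]) x : scalar u -> scalar g ->
  tform u g (cm_delta M k (cm_L 0 x)) =
    tform u (fun y => g (cm_L 0 y)) (cm_delta M k x)
    + tform (fun v => u (voc_L 0 v)) g (cm_delta M k x)
    - (k + 1)%:~R * tform u g (cm_delta M k x).
Proof.
move=> lu lg; rewrite -mulNr -rmorphN.
apply: (@L0_commutator R V int (voc_comodule V) M M (fun k => cm_delta M k)) => //.
- exact: voc_separated.
- exact: voc_separated.
- exact: comodule_separated.
- by move=> t; exact: delta_linear.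
- exact: cm_trunc M_adm.
- move=> t y; under eq_fun => i do rewrite natz.
  exact: (@trunc_eventually0 _ (fun k => cm_delta M k y) _ (cm_trunc M_adm y)).
- exact: cm_jacobi M_adm.
by have [-> _] := cm_derivative M_adm (k + 1) x; rewrite addrK.
Qed.

(** The functional ρ sits in degree 2, which cancels the shift by 2 of the mode
    that defines L(0). *)
Lemma cm_L0_gr t x : cm_gr M t x -> cm_gr M t (cm_L 0 x).
Proof.
move=> gx; have Sgr s : subspace (cm_gr M s) by exact: (cm_grading M_adm).1.
have := tforml_gr (r := 2) Sgr (@rho_scalar R V) _
  (cm_delta_gr M_adm (1 - 0) gx).
have -> : t%:Z + (1 - 0) + 1 - 2 = t%:Z by rewrite subr0 -addrA addrK.
apply=> s v s2 gv; exact: rho_wt2 gv s2.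
Qed.

(** Contracting the left factor with u changes degree and L(0)-weight by the same
    integer k + 1 - r, so that their difference h is preserved. *)
Lemma coaction_weight (h : R[i]) k r t (u : V -> R[i]) (x : M) : scalar u ->
  (forall i v, i != r -> voc_gr V i v -> u v = 0) ->
  cm_gr M t x -> cm_L 0 x = (h + t%:R) *: x ->
  tforml u (cm_delta M k x) = 0 \/ exists s,
    cm_gr M s (tforml u (cm_delta M k x)) /\
    cm_L 0 (tforml u (cm_delta M k x)) =
      (h + s%:R) *: tforml u (cm_delta M k x).
Proof.
move=> lu u0 gx Lx; set z := tforml u _.
have Sgr s : subspace (cm_gr M s) by exact: (cm_grading M_adm).1.
have := tforml_gr Sgr lu u0 (cm_delta_gr M_adm k gx); rewrite -/z.
case E : (t%:Z + k + 1 - r) => [s|s]; last by left.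
move=> gz; right; exists s; split=> //.
apply/eqP; rewrite -subr_eq0; apply/eqP; apply: comodule_separated => g lg.
have uL v : u (voc_L 0 v) = r%:~R * u v.
  have [pr prP] := direct_sum_proj (voc_grading V_voc).
  move: v; apply: (grading_ext prP (s := *%R) (f := fun v => u (voc_L 0 v))
    (g := fun v => r%:~R * u v)).
  - exact: scalar_comp (@cm_L_linear _ _ (voc_comodule V) 0) lu.
  - by move=> a y y'; rewrite lu mulrDr mulrCA.
  move=> i v gv; move: (gv); rewrite (voc_L0 V_voc) /= => ->.
  rewrite (linZ lu) /=; have [->//|ir] := eqVneq i r.
  by rewrite (u0 i v ir gv) !mulr0.
rewrite (linB lg) (linZ lg) /=.
rewrite /z (tforml_form (g := fun y => g (cm_L 0 y))) //; last first.
  exact: scalar_comp (@cm_L_linear _ _ M 0) lg.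
rewrite tforml_form //; have := coaction_L0 k x lu lg.
have -> : (fun v => u (voc_L 0 v)) = fun v => r%:~R * u v + 0.
  by apply/funext => v; rewrite uL addr0.
rewrite tform_linl Lx (linZ (@delta_linear _ _ M k)).
rewrite (linZ (tform_scalar lu lg)) /=.
have -> : tform (fun=> 0) g (cm_delta M k x) = 0.
  by rewrite /tform /tlift /tsum big1 // => p _; rewrite mul0r.
have -> : s%:R = (t%:Z + k + 1 - r)%:~R :> R[i] by rewrite E.
set w := tform u g _; set w' := tform u _ _ => /eqP.
rewrite addr0 -addrA -mulrBl -subr_eq => /eqP <-.
ring.
Qed.

(** Schur's lemma for the operator L(0) - (degree): it commutes with the
    coaction, so the eigenvectors for one eigenvalue, which exist in a finite
    dimensional homogeneous component, generate a graded subcomodule. *)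
Lemma simple_weight_graded : simple_comodule M -> exists h, weight_graded M h.
Proof.
move=> [_ M0 Msimple]; have [pr prP] := direct_sum_proj (cm_grading M_adm).
have [x x0] : exists x : M, x != 0.
  apply: contrapT => nx; apply: M0; apply/seteqP; split=> // x _ /=.
  by apply/eqP/negPn/negP => x0; apply: nx; exists x.
have [t xt0] : exists t, pr t x != 0.
  apply: contrapT => nt; case/eqP: x0; apply: (proj_eq0 prP) => t.
  by apply/eqP/negPn/negP => xt0; apply: nt; exists t.
have Sgr s : subspace (cm_gr M s) by exact: (cm_grading M_adm).1.
have [y [gy y0 [l Ly]]] := eigenvector (@cm_L_linear _ _ M 0) (Sgr t) (M_fin t)
  (@cm_L0_gr t) (gp_in prP t x) xt0.
pose h := l - t%:R.
pose G : set M := [set z | exists s, cm_gr M s z /\ cm_L 0 z = (h + s%:R) *: z].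
have GM : Defs.span G = setT.
  have [||G0|//] := Msimple (Defs.span G) _ _.
  - split; first exact: span_subspace.
      apply: span_min => [|z Gz]; first exact: span_subspace.
      apply: mem_span; split; first exact: mem_span.
      by case: Gz => s [gz _]; exists s.
    move=> k; apply: (@span_min _ _ _ [set z | Defs.span
        [set w | exists v z', Defs.span G z' /\ w = v ⊗ z'] (cm_delta M k z)]).
      split=> [|a z w /= Gz Gw].
        by rewrite /= linear0; exact: (span_subspace _).1.
      by rewrite linearP; exact: (span_subspace _).2.
    move=> z [s [gz Lz]] /=.
    have [r [rA ->]] := tensor_frame (cm_delta M k z)
      (gdual_functional_space (voc_gr V))
      (gdual_separating (voc_grading V_voc) (voc_fin_dim V_voc)).
    apply: subspace_sum; first exact: span_subspace.
    move=> p /rA up; apply: mem_span; exists p.1, (tforml p.2 (cm_delta M k z)).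
    split=> //; have [prV prVP] := direct_sum_proj (voc_grading V_voc).
    have [s' _ ->] := gdual_sum prVP up.
    have /gdual_predP [lu _] := up.
    rewrite tforml_sum; apply: subspace_sum => [|j _]; first exact: span_subspace.
    have luj : scalar (fun v => p.2 (prV j v)).
      exact: scalar_comp (gp_lin prVP j) lu.
    have luj0 i v : i != j -> voc_gr V i v -> p.2 (prV j v) = 0.
      by move=> ij gv; rewrite (gp_neq prVP gv) ?(lin0 lu) // eq_sym.
    have [->|[s1 [gz1 Lz1]]] := coaction_weight k luj luj0 gz Lz.
    + exact: (span_subspace _).1.
    + by apply: mem_span; exists s1.
  - by [].
  - have : Defs.span G y.
      by apply: mem_span; exists t; rewrite /h subrK.
    by rewrite G0 => /= y_0; rewrite y_0 eqxx in y0.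
exists h => s z gz; have : Defs.span G z by rewrite GM.
rewrite -{2 3}(gp_id prP gz); move: z {gz}.
apply: (@span_min _ _ _ [set z | cm_L 0 (pr s z) = (h + s%:R) *: pr s z]).
  split=> [|a z w /= Ez Ew].
    by rewrite /= (lin0 (gp_lin prP s)) (lin0 (@cm_L_linear _ _ M 0)) scaler0.
  rewrite (gp_lin prP s) (@cm_L_linear _ _ M 0) Ez Ew scalerDr !scalerA.
  by rewrite [a * _]mulrC.
move=> z [s' [gz Lz]] /=; have [->|ss'] := eqVneq s s'.
  by rewrite (gp_id prP gz).
by rewrite (gp_neq prP gz ss') (lin0 (@cm_L_linear _ _ M 0)) scaler0.
Qed.

End Schur.

(** * Duals of comodules *)

Section DualOf.
Variables (R : realType) (V : voc_data R).

(** The evaluation ev identifies the V'-module N with the graded dual of M.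
    Both V' as a module over itself, with its own grading, and the graded dual
    of a comodule are instances, so that properties of duals need to be shown
    only once. *)
Record dual_of (M : comod_data V) (N : mod_data (dual_voa V))
    (ev : N -> M -> R[i]) : Prop := DualOf {
  do_lin : forall x, scalar (ev^~ x);
  do_inj : injective ev;
  do_range : forall f : M -> R[i],
    (f : M -> R[i]^o) \in gdual_pred (cm_gr M) <-> exists n, ev n = f;
  do_mode : forall k (u : gdual (voc_gr V)) n,
    ev (md_mode N k u n) = fun x => tform u (ev n) (cm_delta M k x);
  do_gr : forall t n, md_gr N t n <->
    forall s x, s != t -> cm_gr M s x -> ev n x = 0
}.

Lemma gdual_linl (M : lmodType R[i]) (J : choiceType) (gr : J -> set M) x :
  scalar (fun f : gdual gr => f x : R[i]).
Proof. by []. Qed.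

Lemma gdual_comb (M : lmodType R[i]) (J : choiceType) (gr : J -> set M) a
    (f f' : gdual gr) :
  (a *: f + f' : gdual gr) = (fun x => a * f x + f' x) :> (M -> R[i]).
Proof. by []. Qed.

Lemma to_gdualK (M : lmodType R[i]) (J : choiceType) (gr : J -> set M)
    (f : M -> R[i]) : (f : M -> R[i]^o) \in gdual_pred gr ->
  (to_gdual gr f : M -> R[i]) = f.
Proof. by move=> fgr; rewrite /to_gdual; apply: insubdK. Qed.

Lemma gdual_fun_inj (M : lmodType R[i]) (J : choiceType) (gr : J -> set M) :
  injective (fun f : gdual gr => (f : M -> R[i])).
Proof. exact: val_inj. Qed.

Lemma gdual_scalar (M : lmodType R[i]) (J : choiceType) (gr : J -> set M)
  (f : gdual gr) : scalar (f : M -> R[i]).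
Proof. exact: (gdualP f).1. Qed.

Lemma dual_module_dual (M : comod_data V) : admissible_comodule M ->
  @dual_of M (dual_module M) (fun f => f).
Proof.
move=> M_adm; split.
- exact: gdual_linl.
- exact: gdual_fun_inj.
- move=> f; split=> [fgr|[n <-]]; last exact: valP.
  by exists (to_gdual _ f); exact: to_gdualK.
- move=> k u n /=; rewrite to_gdualK //.
  apply: (tform_gdual (emb := Posz) (D := cm_delta M k) (k := k)).
    by move=> a b [].
  by move=> t x; exact: cm_delta_gr.
- by [].
Qed.

Hypothesis V_voc : is_voc V.

(** A component of V vanishes exactly if its dual does, so both gradings are
    shifted by the same amount. *)
Lemma voa_low_voc : voa_low (dual_voa V) = voc_low V.
Proof.
rewrite /voa_low /voc_low; congr xget; apply/seteqP.
have [pr prP] := direct_sum_proj (voc_grading V_voc).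
have eq0 s : voa_gr (dual_voa V) s = [set 0] <-> voc_gr V s = [set 0].
  split=> E; apply/seteqP; split=> //.
  - move=> v gv /=.
    apply: (gdual_separating (voc_grading V_voc) (voc_fin_dim V_voc)).
    move=> u ug; have [lu _] := (gdual_predP _ _).1 ug.
    have up := @proj_functional _ _ _ _ _ u s prP (fun a x y _ _ => lu a x y).
    have : voa_gr (dual_voa V) s (to_gdual (voc_gr V) (fun x => u (pr s x))).
      move=> i x is_ gx; rewrite to_gdualK // (gp_neq prP gx) ?(lin0 lu) //.
      by rewrite eq_sym.
    rewrite E => /= /(congr1 (fun f : gdual (voc_gr V) => f v)).
    by rewrite to_gdualK // (gp_id prP gv).
  - by move=> v /= ->; exact: (grading_subspace prP s).1.
  - move=> f gf /=; apply: gdual_fun_inj; apply/funext.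
    apply: (grading_ext prP (s := *%R) (gdual_scalar f)) => [a x y|i x gx].
      by rewrite /= mulr0 addr0.
    have [is_|is_] := eqVneq i s; last exact: gf is_ gx.
    by move: gx; rewrite is_ E => /= ->; rewrite (lin0 (gdual_scalar f)).
  - by move=> _ -> i x _ _.
by split=> s0 s0P s /s0P /eq0.
Qed.

Lemma voa_module_dual :
  @dual_of (voc_comodule V) (voa_module (dual_voa V)) (fun f => f).
Proof.
have [pr prP] := direct_sum_proj (voc_grading V_voc).
split.
- exact: gdual_linl.
- exact: gdual_fun_inj.
- move=> f; split.
    move=> /gdual_predP [lf [s s0]].
    have fgr : (f : V -> R[i]^o) \in gdual_pred (voc_gr V).
      apply/gdual_predP; split=> //; exists [seq voc_low V + t%:Z | t <- s].
      move=> i v iN gv; have [->|[t it]] := voc_gr_nat V_voc gv.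
        exact: (lin0 lf).
      rewrite it in iN gv; apply: (s0 t) gv; apply: contra iN.
      exact: (map_f (fun t => voc_low V + t%:Z)).
    by exists (to_gdual _ f); exact: to_gdualK.
  move=> [n <-]; have [ln [s s0]] := gdualP n; apply/gdual_predP; split=> //.
  exists [seq `|i - voc_low V|%N | i <- s] => t x tN gx; apply: s0 gx.
  apply: contra tN => ts; apply/mapP; exists (voc_low V + t%:Z) => //.
  by rewrite addrC addKr.
- move=> k u n /=; rewrite to_gdualK //.
  apply: (tform_gdual (emb := id) (D := voc_delta V k) (k := k)).
    by [].
  by move=> t x; exact: voc_delta_gr.
- move=> t n; rewrite /= voa_low_voc; split=> [gn s x st|gn i x it gx].
    by apply: gn; rewrite (inj_eq (addrI _)).
  have [->|[s is_]] := voc_gr_nat V_voc gx.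
    exact: (lin0 (gdual_scalar n)).
  apply: (gn s); last by rewrite /= -is_.
  by apply: contra it => /eqP <-; rewrite is_.
Qed.

Section Theory.
Variables (M : comod_data V) (N : mod_data (dual_voa V)) (ev : N -> M -> R[i]).
Hypotheses (M_adm : admissible_comodule M) (MN : dual_of ev).

Lemma do_gdual n : (ev n : M -> R[i]^o) \in gdual_pred (cm_gr M).
Proof. by apply/(do_range MN); exists n. Qed.

Lemma do_scalar n : scalar (ev n).
Proof. by have /gdual_predP [] := do_gdual n. Qed.

Lemma dual_mode_bilinear k : bilinear_for *:%R *:%R (md_mode N k).
Proof.
split=> [n|u] a x y; apply: (do_inj MN); apply/funext => z.
  by rewrite (do_lin MN z) /= !(do_mode MN) gdual_comb tform_linl.
rewrite (do_lin MN z) /= !(do_mode MN) -tform_linr; congr tform.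
by apply/funext => w; rewrite (do_lin MN w).
Qed.

(** u and ev n vanish above some degrees with sum K, and for k > K the mode k
    of the coaction lands in total degree beyond K. *)
Lemma dual_trunc (u : dual_voa V) n :
  exists k0 : int, forall k, (k0 < k)%R -> md_mode N k u n = 0.
Proof.
have [pr prP] := direct_sum_proj (cm_grading M_adm).
have [lu [su u0]] := gdualP u; have /gdual_predP [ln [sn n0]] := do_gdual n.
pose K := \sum_(r <- su) `|r|%N + \sum_(s <- sn) s.
exists K%:Z => k Kk; apply: (do_inj MN); apply/funext => x.
rewrite (lin0 (do_lin MN x)) (do_mode MN).
move: x; apply: (grading_ext prP (s := *%R)
  (f := fun x => tform u (ev n) (cm_delta M k x)) (g := fun=> 0)).
- exact: scalar_comp (@delta_linear _ _ M k) (tform_scalar lu ln).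
- by move=> a x y; rewrite /= mulr0 addr0.
move=> t x gx; apply: (tform_gr0 lu ln _ (cm_delta_gr M_adm k gx)).
move=> r s v w rs gv gw.
have [rsu|rsu] := boolP (r \in su); last by rewrite (u0 r) ?mul0r.
have [ssn|ssn] := boolP (s \in sn); last by rewrite (n0 s) ?mulr0.
have r_le : (`|r|%N <= \sum_(r <- su) `|r|)%N.
  by rewrite (big_rem r) //= leq_addr.
have s_le : (s <= \sum_(s <- sn) s)%N by rewrite (big_rem s) //= leq_addr.
have : (r + s%:Z <= K%:Z)%R.
  rewrite /K PoszD lerD // ?lez_nat //.
  by rewrite (le_trans (ler_norm r)) // -abszE lez_nat.
rewrite rs leNgt => /negP []; apply: (lt_le_trans Kk).
by rewrite addrAC lerDr -PoszD.
Qed.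

Lemma dual_trunc_eventually0 k (u : dual_voa V) n :
  eventually0 (fun i => md_mode N (k + i%:Z) u n).
Proof.
have [k0 H] := dual_trunc u n; exists `|k0 - k|.+1 => i ki; apply: H.
rewrite -ltrBlDl; apply: (le_lt_trans (ler_norm _)).
by rewrite -abszE ltz_nat.
Qed.

(** The graded dual is graded as well: a functional in it lives in finitely many
    degrees, hence is the finite sum of its restrictions to them. *)
Lemma dual_proj (pr : nat -> M -> M) : grading_proj (cm_gr M) pr ->
  exists2 prN, grading_proj (md_gr N) prN
    & forall t n x, ev (prN t n) x = ev n (pr t x).
Proof.
move=> prP.
have prN_ex t n : exists n', ev n' = fun x => ev n (pr t x).
  apply/(do_range MN); apply: (@proj_functional _ _ _ _ _ (ev n) t prP).
  by move=> a x y _ _; exact: do_scalar.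
pose prN t n := projT1 (cid (prN_ex t n)).
have prNE t n x : ev (prN t n) x = ev n (pr t x).
  by rewrite /prN; case: (cid _) => /= n' ->.
exists prN => //; split.
- move=> t a n n'; apply: (do_inj MN); apply/funext => x.
  by rewrite (do_lin MN) /= !prNE (do_lin MN).
- move=> t n; apply/(do_gr MN) => s x st gx.
  by rewrite prNE (gp_neq prP gx) ?(lin0 (do_scalar n)) // eq_sym.
- move=> t n /(do_gr MN) gn; apply: (do_inj MN); apply/funext => x.
  rewrite prNE; move: x; apply: (grading_ext prP (s := *%R)
    (f := fun x => ev n (pr t x))).
  + exact: scalar_comp (gp_lin prP t) (do_scalar n).
  + exact: do_scalar.
  move=> s x gx; have [st|st] := eqVneq t s; first by rewrite st (gp_id prP gx).
  rewrite (gp_neq prP gx st) (lin0 (do_scalar n)) (gn s x) //.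
  by rewrite eq_sym.
- move=> s t n /(do_gr MN) gn ts; apply: (do_inj MN); apply/funext => x.
  rewrite prNE (lin0 (do_lin MN x)); apply: (gn t) => //.
  exact: (gp_in prP).
move=> n; have [s us nE] := gdual_sum prP (do_gdual n).
have /gdual_predP [_ [s' s'0]] := do_gdual n.
have prN0 t : t \notin undup s' -> prN t n = 0.
  rewrite mem_undup => ts; apply: (do_inj MN); apply/funext => x.
  rewrite prNE (lin0 (do_lin MN x)); apply: s'0 ts _; exact: (gp_in prP).
exists (undup (s ++ s')); split; first exact: undup_uniq.
  move=> t; rewrite mem_undup mem_cat negb_or => /andP [_ ts'].
  by apply: prN0; rewrite mem_undup.
apply: (do_inj MN); apply/funext.
apply: (grading_ext prP (do_scalar n)).
  move=> a x y; exact: do_scalar.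
move=> t x gx; rewrite (lin_sum (do_lin MN x)).
have [ts|ts] := boolP (t \in undup (s ++ s')).
  rewrite (bigD1_seq t) ?undup_uniq //= prNE (gp_id prP gx) big1 ?addr0 //.
  by move=> i it; rewrite prNE (gp_neq prP gx it) (lin0 (do_scalar n)).
rewrite big_seq big1; last first.
  move=> i is_; rewrite prNE (gp_neq prP gx) ?(lin0 (do_scalar n)) //.
  by apply: contraNneq ts => <-.
apply: (s'0 t x) => //; apply: contra ts => ts.
by rewrite mem_undup mem_cat ts orbT.
Qed.

Lemma dual_subspace t : subspace (md_gr N t).
Proof.
split; first by apply/(do_gr MN) => s x _ _; exact: (lin0 (do_lin MN x)).
move=> a n n' /(do_gr MN) gn /(do_gr MN) gn'; apply/(do_gr MN) => s x st gx.
by rewrite (do_lin MN) /= (gn s) // (gn' s) // mulr0 addr0.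
Qed.

End Theory.
End DualOf.

(** * Duals of simple comodules *)

Lemma simple_fin_semisimple (F : fieldType) (U : lmodType F) (sub : set U -> Prop) :
  simple_sub sub setT -> fin_semisimple sub.
Proof.
move=> Us; exists 1%N, (fun=> setT); split=> //; split=> [j|n].
  by split.
exists (fun=> n); split.
  split=> //; first exact: finite_finset.
  by rewrite (@fsum_seq _ _ _ [:: ord0]) ?big_seq1 // => j; rewrite (ord1 j).
move=> f [_ _]; rewrite (@fsum_seq _ _ _ [:: ord0]) ?big_seq1.
- by move=> ->; apply/funext => j; rewrite (ord1 j).
- by [].
- by move=> j; rewrite (ord1 j).
Qed.

Section DualObject.
Variables (R : realType) (V : voc_data R) (V_voc : is_voc V).
Variables (M : comod_data V) (N : mod_data (dual_voa V)) (ev : N -> M -> R[i]).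
Hypotheses (M_adm : admissible_comodule M) (MN : dual_of ev).
Hypothesis M_fin : forall t, fin_dim (cm_gr M t).

Lemma dual_jacobi :
  jacobi (voa_mode (dual_voa V)) (md_mode N) (md_mode N) (md_mode N).
Proof.
have VV := voa_module_dual V_voc.
have bil := dual_mode_bilinear MN.
have := transpose_jacobi (D1 := fun k => voc_delta V k)
  (D2 := fun k => cm_delta M k) (D3 := fun k => cm_delta M k)
  (W := fun k => cm_delta M k) (evA := fun u : gdual (voc_gr V) => u)
  (ev1 := fun u : gdual (voc_gr V) => u) (ev2 := ev) (do_lin MN) (do_inj MN)
  (do_mode VV) (do_mode MN) (do_mode MN) (do_mode MN).
move=> tj; apply/tj => {tj}.
- by move=> k u; exact: (lin0 ((bil k).2 u)).
- by move=> k n; exact: (lin0 ((bil k).1 n)).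
- by move=> k u; exact: (lin0 ((bil k).2 u)).
- exact: (dual_trunc_eventually0 (voc_comodule_admissible V_voc) VV).
- exact: (dual_trunc_eventually0 M_adm MN).
- move=> t n p; under eq_fun => i do rewrite natz.
  exact: (dual_trunc_eventually0 M_adm MN).
have tr (m : int) (x : M) : eventually0 (fun i => cm_delta M (m - i%:Z) x).
  exact: (@trunc_eventually0 _ (fun k => cm_delta M k x) _ (cm_trunc M_adm x)).
have tr' (t : int) (x : M) : eventually0 (fun i => cm_delta M (t - i%:R) x).
  by under eq_fun => i do rewrite natz.
move=> l m t u n p x.
have sepM := comodule_separated M_adm M_fin; have sepV := voc_separated V_voc.
have [+ _] := (co_jacobi_at (D1 := fun k => voc_delta V k)
  (D2 := fun k => cm_delta M k) (D3 := fun k => cm_delta M k)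
  (W := fun k => cm_delta M k) (@delta_linear _ _ (voc_comodule V))
  (@delta_linear _ _ M) (@delta_linear _ _ M) tr tr'
  (scalar_functional_space V) sepV (scalar_functional_space V) sepV
  (scalar_functional_space M) sepM).
move=> /(_ (cm_jacobi M_adm)); apply; [exact: gdual_scalar..|].
exact: (do_scalar MN).
Qed.

Lemma dual_admissible : admissible_module N.
Proof.
have [pr prP] := direct_sum_proj (cm_grading M_adm).
have [prN prNP prNE] := dual_proj MN prP.
split.
- exact: (proj_direct_sum prNP (dual_subspace MN)).
- exact: (dual_mode_bilinear MN).
- exact: (dual_trunc M_adm MN).
- move=> k n; apply: (do_inj MN); apply/funext => x.
  rewrite (do_mode MN) /= to_gdualK; last exact: c_gdual.
  rewrite -tforml_form; [|exact: c_scalar|exact: (do_scalar MN)].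
  rewrite (cm_counit M_adm); case: eqP => // _.
  by rewrite (lin0 (do_scalar MN n)) (lin0 (do_lin MN x)).
- exact: dual_jacobi.
move=> r k t u n ur nt.
have mode0 s x : r + t%:Z - k - 1 != s%:Z -> cm_gr M s x ->
    ev (md_mode N k u n) x = 0.
  move=> ns gx; rewrite (do_mode MN).
  apply: (tform_gr0 (gdual_scalar u) (do_scalar MN n) _
    (cm_delta_gr M_adm k gx)).
  move=> r' s' v w rs gv gw; have [rr|rr] := eqVneq r' r; last first.
    by have -> := ur r' v rr gv; rewrite mul0r.
  have [ss|ss] := eqVneq s' t; last first.
    by rewrite ((do_gr MN t n).1 nt s' w ss gw) mulr0.
  case/eqP: ns; rewrite -rr -ss rs; lia.
case E : (r + t%:Z - k - 1) => [s|s].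
  apply/(do_gr MN) => s' x ss gx; apply: mode0 gx; rewrite E.
  by apply: contra ss => /eqP [->].
apply: (do_inj MN); apply/funext => x; rewrite (lin0 (do_lin MN x)).
move: x; apply: (grading_ext prP (do_scalar MN _)) => [a x y|s' x gx].
  by rewrite /= mulr0 addr0.
by apply: mode0 gx; rewrite E.
Qed.

(** Annihilators reverse inclusions between submodules of N and subcomodules
    of M, so a simple comodule has a simple dual. *)
Lemma dual_simple : simple_comodule M ->
  simple_sub (@submodule R (dual_voa V) N) setT.
Proof.
move=> [_ M0 Msimple].
have [pr prP] := direct_sum_proj (cm_grading M_adm).
have [prN prNP prNE] := dual_proj MN prP.
have sepM := gdual_separating (cm_grading M_adm) M_fin.
split.
- split=> //.
  move=> n _; have [s [_ _ ->]] := gp_sum prNP n.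
  apply: subspace_sum; first exact: span_subspace.
  move=> t _; apply: mem_span; split=> //.
  by exists t; exact: (gp_in prNP).
- move=> N0; apply: M0; apply/seteqP; split=> // x _; apply: sepM => f.
  move=> /(do_range MN) [n <-]; have : [set: N] n by [].
  by rewrite N0 => /= ->; rewrite (lin0 (do_lin MN x)).
move=> T [Tsub Thom Tmod] _.
have T_pr t n : T n -> T (prN t n).
  move=> /Thom; move: n; apply: (@span_min _ _ _ [set n | T (prN t n)]).
    split=> [|a n n' Tn Tn'].
      by rewrite /= (lin0 (gp_lin prNP t)); exact: Tsub.1.
    by rewrite /= (gp_lin prNP t); exact: Tsub.2.
  move=> n [Tn [s gn]] /=; have [->|ts] := eqVneq t s.
    by rewrite (gp_id prNP gn).
  by rewrite (gp_neq prNP gn ts); exact: Tsub.1.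
pose A : set M := [set x | forall n, T n -> ev n x = 0].
have Asub : subspace A.
  split=> [n _|a x y Ax Ay n Tn]; first exact: (lin0 (do_scalar MN n)).
  by rewrite (do_scalar MN n) Ax // Ay // mulr0 addr0.
have [||A0|AT] := Msimple A _ _.
- split=> //.
    move=> x Ax; have [s [_ _ ->]] := gp_sum prP x.
    apply: subspace_sum; first exact: span_subspace.
    move=> t _; apply: mem_span; split; last by exists t; exact: (gp_in prP).
    by move=> n Tn; rewrite -prNE; apply: Ax; exact: T_pr.
  move=> k x Ax; have [r [rA ->]] := tensor_frame (cm_delta M k x)
    (gdual_functional_space (voc_gr V))
    (gdual_separating (voc_grading V_voc) (voc_fin_dim V_voc)).
  apply: subspace_sum; first exact: span_subspace.
  move=> p /rA up; apply: mem_span; exists p.1, (tforml p.2 (cm_delta M k x)).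
  split=> // n Tn; have /gdual_predP [lu _] := up.
  rewrite tforml_form //; last exact: (do_scalar MN).
  have := Ax _ (Tmod k (to_gdual (voc_gr V) p.2) n Tn).
  by rewrite (do_mode MN) to_gdualK.
- by [].
- right; apply/seteqP; split=> // n _.
  have [s [_ _ ->]] := gp_sum prNP n; apply: subspace_sum => // t _.
  set m := prN t n.
  (* The elements of T separate M, so they contain a frame for the degree t part. *)
  pose B : set (M -> R[i]) := [set f | exists2 n', T n' & ev n' = f].
  have Bf : functional_space B.
    split=> [f [n' _ <-]|a f f' [n1 T1 <-] [n2 T2 <-]]; first exact: (do_scalar MN).
    exists (a *: n1 + n2); first exact: Tsub.2.
    by apply/funext => x; rewrite (do_lin MN x).
  have Bs : separating B.
    move=> x x0; have : A x by move=> n' Tn'; apply: x0; exists n'.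
    by rewrite A0.
  have [l lM] := M_fin t.
  have [r [rB rE]] := dual_frame l Bf Bs.
  have lift p : exists n', p \in r -> T n' /\ ev n' = fun x => p.2 (pr t x).
    have [pr_|_] := boolP (p \in r); last by exists 0.
    have [n1 T1 n1E] := rB p pr_; exists (prN t n1) => _; split; first exact: T_pr.
    by apply/funext => y; rewrite prNE n1E.
  pose c p := projT1 (cid (lift p)); have cP p := projT2 (cid (lift p)).
  have -> : m = \sum_(p <- r) ev m p.1 *: c p.
    apply: (do_inj MN); apply/funext.
    apply: (grading_ext prP (do_scalar MN m)); first exact: (do_scalar MN _).
    move=> s' x gx; rewrite (lin_sum (do_lin MN x)).
    under eq_big_seq => p /cP [_ cE] do rewrite (linZ (do_lin MN x)) /= cE.
    have [ts|ts] := eqVneq t s'; last first.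
      rewrite (gp_neq prP gx ts) big_seq big1.
        by apply: ((do_gr MN t _).1 (gp_in prNP t n)) gx; rewrite eq_sym.
      by move=> p /rB /Bf.1 lp; rewrite (lin0 lp) mulr0.
    rewrite -ts in gx; rewrite (gp_id prP gx) {1}(rE x (lM _ gx)).
    rewrite (lin_sum (do_scalar MN m)); apply: eq_bigr => p _.
    by rewrite (linZ (do_scalar MN m)) /= mulrC.
  apply: subspace_sum => // p /cP [Tc _]; exact: subspaceZ.
- left; apply/seteqP; split=> [n Tn /=|n ->]; last exact: Tsub.1.
  apply: (do_inj MN); apply/funext => x; rewrite (lin0 (do_lin MN x)).
  by have : A x by [rewrite AT]; apply.
Qed.

Lemma dual_obj : simple_comodule M -> module_obj N.
Proof.
move=> Ms; have Ns := dual_simple Ms.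
split; first exact: dual_admissible.
exact: simple_fin_semisimple.
Qed.

End DualObject.

(** * Duals of isomorphic comodules *)

Lemma Re_add (R : realType) (x y : R[i]) :
  complex.Re (x + y) = complex.Re x + complex.Re y.
Proof. by case: x; case: y. Qed.

Lemma Re_opp (R : realType) (x : R[i]) : complex.Re (- x) = - complex.Re x.
Proof. by case: x. Qed.

Lemma Re_nat (R : realType) n : complex.Re (n%:R : R[i]) = n%:R.
Proof. by elim: n => [//|n IH]; rewrite -!natr1 Re_add IH. Qed.

Lemma nat_gt (R : realType) (B : R) :
  exists n : nat, forall m, (n <= m)%N -> (B < m%:R)%R.
Proof.
exists (Num.bound `|B|) => m nm; apply: (le_lt_trans (ler_norm B)).
by apply: (lt_le_trans (archi_boundP (normr_ge0 B))); rewrite ler_nat.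
Qed.

Section DualIso.
Variables (R : realType) (V : voc_data R).

(** The hypothesis on weights of [gdual_weightP] for a grading bounded below. *)
Lemma weight_large (M : comod_data V) (h : R[i]) (B : R) : exists s : seq nat,
  forall j (x : M), j \notin s -> cm_gr M j x -> x != 0 ->
    (B < complex.Re (h + j%:R))%R.
Proof.
have [n nP] := nat_gt (B - complex.Re h); exists (iota 0 n) => j x.
rewrite mem_iota /= add0n -leqNgt => /nP; rewrite Re_add Re_nat ltrBlDl //.
Qed.

(** An isomorphism of comodules need not preserve the gradings, but it commutes
    with L(0), whose weights determine the graded dual. *)
Lemma dual_iso (M M' : comod_data V) (N N' : mod_data (dual_voa V))
    (ev : N -> M -> R[i]) (ev' : N' -> M' -> R[i]) h h' :
  admissible_comodule M -> admissible_comodule M' ->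
  weight_graded M h -> weight_graded M' h' -> dual_of ev -> dual_of ev' ->
  comodule_iso M M' -> module_iso N' N.
Proof.
move=> adm adm' wt wt' MN MN' [f [[lf fD] [fi fK iK]]].
have [pr prP] := direct_sum_proj (cm_grading adm).
have [pr' prP'] := direct_sum_proj (cm_grading adm').
have fL x : cm_L 0 (f x) = f (cm_L 0 x).
  rewrite /cm_L fD tforml_map //; exact: rho_scalar.
have lid (U : lmodType R[i]) : linear (@id U) by [].
have lfi : linear fi by move=> a x y; rewrite -{1}(iK x) -{1}(iK y) -lf fK.
have gw := gdual_weightP prP (@cm_L_linear _ _ M 0) wt (@weight_large M h).
have gw' := gdual_weightP prP' (@cm_L_linear _ _ M' 0) wt' (@weight_large M' h').
have pull n' : exists n, ev n = fun x => ev' n' (f x).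
  apply/(do_range MN)/gw; have [ln [B nB]] := (gw' _).1 (do_gdual MN' n').
  split; first exact: scalar_comp lf ln.
  by exists B => l x Bl Lx; apply: (nB l) => //; rewrite fL Lx (linZ lf).
have push n : exists n', ev' n' = fun x => ev n (fi x).
  apply/(do_range MN')/gw'; have [ln [B nB]] := (gw _).1 (do_gdual MN n).
  split; first exact: scalar_comp lfi ln.
  exists B => l x Bl Lx; apply: (nB l) => //; apply: (can_inj fK).
  by rewrite -fL iK Lx (linZ lf) iK.
pose p n' := projT1 (cid (pull n')); pose q n := projT1 (cid (push n)).
have pE n' : ev (p n') = fun x => ev' n' (f x) by exact: (projT2 (cid (pull n'))).
have qE n : ev' (q n) = fun x => ev n (fi x) by exact: (projT2 (cid (push n))).
exists p; split; last first.
  exists q => n; [apply: (do_inj MN')|apply: (do_inj MN)]; apply/funext => x.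
    by rewrite qE pE iK.
  by rewrite pE qE fK.
split=> [a x y|k u n'].
  apply: (do_inj MN); apply/funext => z.
  by rewrite (do_lin MN z) /= !pE (do_lin MN' (f z)).
apply: (do_inj MN); apply/funext => z.
rewrite pE (do_mode MN) (do_mode MN') pE fD tform_map //.
- exact: gdual_scalar.
- exact: (do_scalar MN').
Qed.

End DualIso.

(** * Dimensions of related spaces *)

Section DimTransport.
Variables (F : fieldType) (U U' : lmodType F) (S : set U) (T : set U').
Variable rel : U -> U' -> Prop.
Hypothesis rel0 : rel 0 0.
Hypothesis rel_lin : forall a x x' y y', rel x y -> rel x' y' ->
  rel (a *: x + x') (a *: y + y').
Hypothesis rel_funr : forall x y y', rel x y -> rel x y' -> y = y'.
Hypothesis rel_funl : forall x x' y, rel x y -> rel x' y -> x = x'.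
Hypothesis relST : forall x, S x -> exists2 y, T y & rel x y.
Hypothesis relTS : forall y, T y -> exists2 x, S x & rel x y.

(** The relation plays the role of a linear bijection.  It is easier to handle
    than a map, since transposes of arbitrary families need not exist. *)
Lemma has_dim_rel n : has_dim S n -> has_dim T n.
Proof.
move=> [b [Sb bP]]; pose b' i := projT1 (cid2 (relST (Sb i))).
have b'P i : T (b' i) /\ rel (b i) (b' i) by rewrite /b'; case: (cid2 _).
have rel_sum (a : {ffun 'I_n -> F}) : rel (\sum_i a i *: b i) (\sum_i a i *: b' i).
  elim/big_rec2: _ => // i x y _ xy; apply: rel_lin => //; exact: (b'P i).2.
exists b'; split=> [i|y Ty]; first exact: (b'P i).1.
have [x Sx xy] := relTS Ty; have [a [xE aU]] := bP x Sx.
exists a; split; first by apply: rel_funr xy _; rewrite xE.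
move=> a' yE; apply: aU; apply: rel_funl xy _; rewrite yE.
exact: rel_sum.
Qed.

End DimTransport.

Lemma dim_rel (F : fieldType) (U U' : lmodType F) (S : set U) (T : set U')
    (rel : U -> U' -> Prop) :
  rel 0 0 ->
  (forall a x x' y y', rel x y -> rel x' y' -> rel (a *: x + x') (a *: y + y')) ->
  (forall x y y', rel x y -> rel x y' -> y = y') ->
  (forall x x' y, rel x y -> rel x' y -> x = x') ->
  (forall x, S x -> exists2 y, T y & rel x y) ->
  (forall y, T y -> exists2 x, S x & rel x y) -> Defs.dim S = Defs.dim T.
Proof.
move=> r0 rl rr rll ST TS; rewrite /Defs.dim; congr xget; apply/seteqP; split=> n /=.
  exact: (has_dim_rel (rel := rel)).
apply: (has_dim_rel (rel := fun y x => rel x y)) => //.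
- by move=> a y y' x x'; exact: rl.
- by move=> y x x'; exact: rll.
- by move=> y y' x; exact: rr.
Qed.

(** * Graded trilinear forms *)

Lemma fin_dim_upto (F : fieldType) (V : lmodType F) (gr : nat -> set V) K :
  (forall t, fin_dim (gr t)) ->
  exists s : seq V, forall t, (t < K)%N -> gr t `<=` Defs.span [set` s].
Proof.
move=> fd; elim: K => [|K [s sP]]; first by exists [::].
have [s' s'P] := fd K; exists (s ++ s') => t; rewrite ltnS leq_eqVlt.
have sub (s1 : seq V) : {subset s1 <= s ++ s'} ->
    Defs.span [set` s1] `<=` Defs.span [set` s ++ s'].
  move=> s1P; apply: span_min; first exact: span_subspace.
  by move=> y /s1P ys; exact: mem_span.
case/orP => [/eqP -> x /s'P|/sP gs x /gs]; apply: sub => y ys;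
  by rewrite mem_cat ys ?orbT.
Qed.

Section GradedForm.
Variables (R : realType) (V : voc_data R) (M1 M2 M3 : comod_data V).
Hypotheses (adm1 : admissible_comodule M1) (adm2 : admissible_comodule M2).
Hypothesis adm3 : admissible_comodule M3.

Local Notation D1 := (gdual (cm_gr M1)).
Local Notation D2 := (gdual (cm_gr M2)).

Variable Phi : R[i] -> D1 -> D2 -> M3 -> R[i].
Variable delta : R[i].

(** What an operator and its transpose have in common: a form whose support
    satisfies a degree relation.  Truncation and finiteness of supports on
    either side are consequences of it. *)
Record graded_form : Prop := GradedForm {
  gf_lin1 : forall t g x, scalar (fun f => Phi t f g x);
  gf_lin2 : forall t f x, scalar (fun g => Phi t f g x);
  gf_lin3 : forall t f g, scalar (Phi t f g);
  gf_deg : forall t a b n f g x, gdual_gr a f -> gdual_gr b g -> cm_gr M3 n x ->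
    Phi t f g x != 0 -> t = delta + (a + b)%:R - n%:R
}.

Hypothesis gf : graded_form.

(** Replacing f and g by their homogeneous components reduces the claim to the
    degree relation. *)
Lemma form_support t n f g x : cm_gr M3 n x -> Phi t f g x != 0 ->
  exists a b y z, [/\ t = delta + (a + b)%:R - n%:R,
    cm_gr M1 a y /\ f y != 0 & cm_gr M2 b z /\ g z != 0].
Proof.
move=> gx Pt; apply: contrapT => H; case/eqP: Pt.
have [p1 p1P] := direct_sum_proj (cm_grading adm1).
have [p2 p2P] := direct_sum_proj (cm_grading adm2).
have [q1 q1P q1E] := dual_proj (dual_module_dual adm1) p1P.
have [q2 q2P q2E] := dual_proj (dual_module_dual adm2) p2P.
have [s1 [_ _ fE]] := gp_sum q1P f; have [s2 [_ _ gE]] := gp_sum q2P g.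
rewrite fE (lin_sum (gf_lin1 gf t g x)) big1 // => a _.
rewrite gE (lin_sum (gf_lin2 gf t _ x)) big1 // => b _.
have [//|Pt] := eqVneq (Phi t (q1 a f) (q2 b g) x) 0.
have nz1 : q1 a f != 0.
  by apply: contra_neq Pt => ->; rewrite (lin0 (gf_lin1 gf t _ x)).
have nz2 : q2 b g != 0.
  by apply: contra_neq Pt => ->; rewrite (lin0 (gf_lin2 gf t _ x)).
have [y fy] : exists y, f (p1 a y) != 0.
  apply: contrapT => nf; case/eqP: nz1; apply: gdual_fun_inj; apply/funext => y.
  by rewrite q1E; apply/eqP/negPn/negP => fy; apply: nf; exists y.
have [z gz] : exists z, g (p2 b z) != 0.
  apply: contrapT => ng; case/eqP: nz2; apply: gdual_fun_inj; apply/funext => z.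
  by rewrite q2E; apply/eqP/negPn/negP => gz; apply: ng; exists z.
case: H; exists a, b, (p1 a y), (p2 b z).
split; [|by split=> //; exact: (gp_in p1P)|by split=> //; exact: (gp_in p2P)].
exact: (gf_deg gf (gp_in q1P a f) (gp_in q2P b g) gx Pt).
Qed.

Lemma gdual_bound (M : lmodType R[i]) (gr : nat -> set M) (f : gdual gr) :
  exists A, forall a x, gr a x -> f x != 0 -> (a <= A)%N.
Proof.
have [_ [s s0]] := gdualP f; exists (\sum_(a <- s) a)%N => a x gx fx.
have : a \in s by apply: contraNT fx => /s0 /(_ gx) ->.
by move=> as_; rewrite (big_rem a) //= leq_addr.
Qed.

Lemma form_gdual t f g :
  (Phi t f g : M3 -> R[i]^o) \in gdual_pred (cm_gr M3).
Proof.
have [A fA] := gdual_bound f; have [B gB] := gdual_bound g.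
have [K KP] := nat_gt (complex.Re (delta - t) + (A + B)%:R).
apply/gdual_predP; split; first exact: (gf_lin3 gf).
exists (iota 0 K) => n x; rewrite mem_iota /= add0n -leqNgt => Kn gx.
apply/eqP/negPn/negP => /(form_support gx) [a [b [y [z [tE [gy fy] [gz gz0]]]]]].
have := KP n Kn; rewrite ltNge => /negP; apply.
have -> : delta - t = n%:R - (a + b)%:R by rewrite tE; ring.
rewrite Re_add Re_opp !Re_nat -addrA lerDl addrC subr_ge0 ler_nat.
by rewrite leq_add // ?(fA a y) ?(gB b z).
Qed.

(** For fixed t and n the sum a + b is determined, so functionals that vanish in
    all low degrees do not contribute. *)
Lemma form_high t n : exists K, forall (f : D1) (g : D2) x, cm_gr M3 n x ->
  (forall a y, (a < K)%N -> cm_gr M1 a y -> f y = 0) \/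
  (forall b z, (b < K)%N -> cm_gr M2 b z -> g z = 0) -> Phi t f g x = 0.
Proof.
have [K KP] := nat_gt (complex.Re (t - delta) + n%:R); exists K => f g x gx fg.
apply/eqP/negPn/negP => /(form_support gx) [a [b [y [z [tE [gy fy] [gz gz0]]]]]].
have Kab : (K <= a + b)%N.
  rewrite leqNgt; apply/negP => abK; case: fg => H.
    by move: fy; rewrite (H a) ?eqxx //; apply: leq_ltn_trans abK; exact: leq_addr.
  by move: gz0; rewrite (H b) ?eqxx //; apply: leq_ltn_trans abK; exact: leq_addl.
have := KP _ Kab; have -> : t - delta = (a + b)%:R - n%:R by rewrite tE; ring.
by rewrite Re_add Re_opp !Re_nat subrK ltxx.
Qed.

Lemma form_trunc_low x : exists B : R, forall t f g,
  (complex.Re t < B)%R -> Phi t f g x = 0.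
Proof.
have [p3 p3P] := direct_sum_proj (cm_grading adm3).
have [s [_ _ xE]] := gp_sum p3P x.
exists (complex.Re delta - (\sum_(n <- s) n)%:R) => t f g tB.
rewrite xE (lin_sum (gf_lin3 gf t f g)) big_seq big1 // => n ns.
apply/eqP/negPn/negP => /(form_support (gp_in p3P n x)) [a [b [_ [_ [tE _ _]]]]].
move: tB; rewrite tE !Re_add Re_opp !Re_nat -addrA ltrD2l ltNge => /negP; apply.
apply: (@le_trans _ _ (- n%:R)); last by rewrite lerDr ler0n.
by rewrite lerN2 ler_nat (big_rem n) //= leq_addr.
Qed.

Lemma form_trunc_high f g : exists B : R, forall t x,
  (B < complex.Re t)%R -> Phi t f g x = 0.
Proof.
have [A fA] := gdual_bound f; have [B gB] := gdual_bound g.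
have [p3 p3P] := direct_sum_proj (cm_grading adm3).
exists (complex.Re delta + (A + B)%:R) => t x tB; move: x.
apply: (grading_ext p3P (gf_lin3 gf t f g)) => [a x y|n x gx].
  by rewrite /= mulr0 addr0.
apply/eqP/negPn/negP => /(form_support gx) [a [b [y [z [tE [gy fy] [gz gz0]]]]]].
move: tB; rewrite tE !Re_add Re_opp !Re_nat -addrA ltrD2l ltNge => /negP; apply.
apply: (@le_trans _ _ (a + b)%:R); first by rewrite gerDl oppr_le0 ler0n.
by rewrite ler_nat leq_add // ?(fA a y) ?(gB b z).
Qed.

Hypotheses (fin1 : forall t, fin_dim (cm_gr M1 t)).
Hypotheses (fin2 : forall t, fin_dim (cm_gr M2 t)).

Let frame (M : comod_data V) (K : nat) : admissible_comodule M ->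
    (forall t, fin_dim (cm_gr M t)) ->
  exists r : seq (M * gdual (cm_gr M)), forall f : gdual (cm_gr M),
    forall a y, (a < K)%N -> cm_gr M a y ->
      (f - \sum_(p <- r) f p.1 *: p.2) y = 0.
Proof.
move=> adm fin; have [s sP] := fin_dim_upto K fin.
have [r [rA rE]] := dual_frame s (gdual_functional_space (cm_gr M))
  (gdual_separating (cm_grading adm) fin).
exists [seq (p.1, to_gdual (cm_gr M) p.2) | p <- r] => f a y aK gy.
have ev_lin := @gdual_linl R M _ (cm_gr M) y.
rewrite (linB ev_lin) (lin_sum ev_lin) /= big_map.
rewrite {1}(rE y (sP a aK y gy)) (lin_sum (gdual_scalar f)).
apply/eqP; rewrite subr_eq0; apply/eqP/eq_big_seq => p /rA pA /=.
rewrite (linZ (gdual_scalar f)) /= to_gdualK //.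
by rewrite mulrC.
Qed.

(** A form of this kind is evaluation at a tensor: for x of degree n and t
    fixed, only finitely many bidegrees contribute and these are finite
    dimensional. *)
Lemma form_represented t x :
  exists y : tensor M1 M2, forall (f : D1) (g : D2), tform f g y = Phi t f g x.
Proof.
have [p3 p3P] := direct_sum_proj (cm_grading adm3).
pose S : set M3 := [set x | exists y : tensor M1 M2,
  forall (f : D1) (g : D2), tform f g y = Phi t f g x].
suff [Ss Sg] : subspace S /\ forall n x, cm_gr M3 n x -> S x.
  have [s [_ _ ->]] := gp_sum p3P x; apply: (subspace_sum (S := S)) => // n _.
  exact: (Sg n _ (gp_in p3P n x)).
split.
  split=> [|a u v [y yE] [z zE]].
    exists 0 => f g; rewrite (lin0 (gf_lin3 gf t f g)).
    exact: (lin0 (tform_scalar (gdual_scalar f) (gdual_scalar g))).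
  exists (a *: y + z) => f g; rewrite (gf_lin3 gf t f g).
  by rewrite (tform_scalar (gdual_scalar f) (gdual_scalar g)) yE zE.
move=> n {}x gx; have [K KP] := form_high t n.
have [r1 r1P] := frame K adm1 fin1; have [r2 r2P] := frame K adm2 fin2.
exists (\sum_(p <- r1) \sum_(q <- r2) Phi t p.2 q.2 x *: (p.1 ⊗ q.1)) => f g.
have lfg := tform_scalar (gdual_scalar f) (gdual_scalar g).
have l1 g' := gf_lin1 gf t g' x; have l2 f' := gf_lin2 gf t f' x.
have -> : Phi t f g x = Phi t (\sum_(p <- r1) f p.1 *: p.2) g x.
  apply/eqP; rewrite -subr_eq0 -(linB (l1 g)); apply/eqP/KP => //; left.
  exact: r1P.
rewrite (lin_sum lfg) (lin_sum (l1 g)); apply: eq_bigr => p _.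
rewrite (linZ (l1 g)) /=.
have -> : Phi t p.2 g x = Phi t p.2 (\sum_(q <- r2) g q.1 *: q.2) x.
  apply/eqP; rewrite -subr_eq0 -(linB (l2 p.2)); apply/eqP/KP => //; right.
  exact: r2P.
rewrite (lin_sum lfg) (lin_sum (l2 p.2)) mulr_sumr; apply: eq_bigr => q _.
rewrite (linZ lfg) (linZ (l2 p.2)) /= tform_tens; [|exact: gdual_scalar..].
by rewrite mulrA mulrC.
Qed.

End GradedForm.

(** * Fusion rules under duality *)

Section ConformalMode.
Variables (R : realType) (V : voc_data R).
Hypothesis rho_wt2 : forall s v, voc_gr V s v -> s != 2 -> voc_rho V v = 0.

Lemma conf_mode (M : comod_data V) k j (f : gdual (cm_gr M)) :
  admissible_comodule M -> k = 1 - j ->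
  (md_mode (dual_module M) k (voa_conf (dual_voa V)) f : gdual (cm_gr M)) =
    (fun x => f (cm_L j x)) :> (M -> R[i]).
Proof.
move=> adm kj; have E := do_mode (dual_module_dual adm) k (voa_conf (dual_voa V)) f.
rewrite [LHS]E /= to_gdualK; last exact: rho_gdual.
by rewrite (rho_cm_L (gdual_scalar f) kj).
Qed.

Lemma gdual_weight (M : comod_data V) h b (g : gdual (cm_gr M)) :
  admissible_comodule M -> weight_graded M h -> gdual_gr b g ->
  (fun y => g (cm_L 0 y)) = fun y => (h + b%:R) * g y.
Proof.
move=> adm wt gb; have [pr prP] := direct_sum_proj (cm_grading adm).
apply/funext; apply: (grading_ext prP (s := *%R) (f := fun y => g (cm_L 0 y))).
- exact: scalar_comp (@cm_L_linear _ _ M 0) (gdual_scalar g).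
- by move=> a x y; rewrite (gdual_scalar g) /= mulrDr mulrCA.
move=> n x gx; rewrite (wt n x gx) (linZ (gdual_scalar g)) /=.
have [<-//|nb] := eqVneq n b.
by rewrite (gb n x nb gx) !mulr0.
Qed.

End ConformalMode.

Section Fusion.
Variables (R : realType) (V : voc_data R) (V_voc : is_voc V).
Hypothesis rho_wt2 : forall s v, voc_gr V s v -> s != 2 -> voc_rho V v = 0.
Variables (M1 M2 M3 : comod_data V).
Hypotheses (adm1 : admissible_comodule M1) (adm2 : admissible_comodule M2).
Hypothesis adm3 : admissible_comodule M3.
Hypothesis fin1 : forall t, fin_dim (cm_gr M1 t).
Hypothesis fin2 : forall t, fin_dim (cm_gr M2 t).
Variables (h1 h2 h3 : R[i]).
Hypotheses (wt1 : weight_graded M1 h1) (wt2 : weight_graded M2 h2).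
Hypothesis wt3 : weight_graded M3 h3.

Local Notation D1 := (gdual (cm_gr M1)).
Local Notation D2 := (gdual (cm_gr M2)).
Local Notation D3 := (gdual (cm_gr M3)).

Lemma Re_trunc_eventually0 (U : zmodType) (W : R[i] -> U) t :
  (exists B : R, forall t : R[i], (complex.Re t < B)%R -> W t = 0) ->
  eventually0 (fun i => W (t - i%:R)).
Proof.
move=> [B WB]; have [K KP] := nat_gt (complex.Re t - B); exists K => i Ki.
by apply: WB; rewrite Re_add Re_opp Re_nat ltrBlDr -ltrBlDl; exact: KP.
Qed.

Lemma Re_trunc_eventually0_high (U : zmodType) (W : R[i] -> U) t :
  (exists B : R, forall t : R[i], (B < complex.Re t)%R -> W t = 0) ->
  eventually0 (fun i => W (t + i%:R)).
Proof.
move=> [B WB]; have [K KP] := nat_gt (B - complex.Re t); exists K => i Ki.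
by apply: WB; rewrite Re_add Re_nat -ltrBlDl; exact: KP.
Qed.

(* The shift between degrees and powers of z, for all operators between the
   M's and between their duals. *)
Let delta := h1 + h2 - h3 - 1.

Lemma degree_of_weights t a b n (w : R[i]) : w != 0 ->
  (h3 + n%:R) * w = (h2 + b%:R) * w + (h1 + a%:R) * w - (t + 1) * w ->
  t = delta + (a + b)%:R - n%:R.
Proof.
rewrite -mulrDl -mulrBl => w0 /(mulIf w0) E.
have -> : t = h2 + b%:R + (h1 + a%:R) - 1 - (h3 + n%:R) by rewrite E; ring.
by rewrite natrD /delta; ring.
Qed.

(** Compare the weights of the two sides of [L0_commutator]. *)
Lemma cointertwining_graded W : cointertwining M1 M2 M3 W ->
  graded_form (fun t (f : D1) (g : D2) x => tform f g (W t x)) delta.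
Proof.
move=> [lW Wtr dW jW]; split.
- by move=> t g x a f f'; rewrite gdual_comb tform_linl.
- by move=> t f x a g g'; rewrite gdual_comb tform_linr.
- move=> t f g; apply: scalar_comp (lW t) _.
  exact: tform_scalar (gdual_scalar f) (gdual_scalar g).
move=> t a b n f g x fa gb gx w0; apply: (degree_of_weights w0).
have lfg := tform_scalar (gdual_scalar f) (gdual_scalar g).
have := @L0_commutator R V R[i] M1 M2 M3 W (voc_separated V_voc)
  (comodule_separated adm1 fin1) (comodule_separated adm2 fin2) lW
  (cm_trunc adm3) _ jW (- (t + 1)) t f g x (gdual_scalar f) (gdual_scalar g).
rewrite (wt3 gx) (linZ (lW t)) (linZ lfg) /= => ->; last first.
- by rewrite -(dW (t + 1) x) addrK.
- by move=> t' x'; exact: (Re_trunc_eventually0 (W := W^~ x')).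
rewrite (gdual_weight adm1 wt1 fa) (gdual_weight adm2 wt2 gb) mulNr.
congr (_ + _ - _).
  have -> : (fun y => (h2 + b%:R) * g y) = fun y => (h2 + b%:R) * g y + 0 * g y.
    by apply/funext => y; rewrite mul0r addr0.
  rewrite tform_linr -[X in _ + X = _](_ : 0 = _) ?addr0 //.
  by rewrite /tform /tlift /tsum big1 // => p _; rewrite mul0r mulr0.
have -> : (fun y => (h1 + a%:R) * f y) = fun y => (h1 + a%:R) * f y + 0 * f y.
  by apply/funext => y; rewrite mul0r addr0.
rewrite tform_linl -[X in _ + X = _](_ : 0 = _) ?addr0 //.
by rewrite /tform /tlift /tsum big1 // => p _; rewrite !mul0r.
Qed.

(** The same comparison of weights, starting from the Jacobi identity of Y
    itself: at this stage Y is not known to be the transpose of an operator W. *)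
Lemma intertwining_graded Y :
  intertwining (dual_module M1) (dual_module M2) (dual_module M3) Y ->
  graded_form (fun t (f : D1) (g : D2) x => (Y t f g : D3) x) delta.
Proof.
move=> [bY Ytr dY jY].
have ev3 x : scalar (fun f : D3 => f x : R[i]) by exact: gdual_linl.
split.
- by move=> t g x a f f'; rewrite [Y t _ g]((bY t).1 g a f f') ev3.
- by move=> t f x a g g'; rewrite [Y t f _]((bY t).2 f a g g') ev3.
- by move=> t f g; exact: gdual_scalar.
move=> t a b n f g x fa gb gx w0; apply: (degree_of_weights w0).
have := jY 0 1 t (voa_conf (dual_voa V)) f g.
rewrite (@fsum_seq _ _ _ [:: 0%N]) //; last first.
  by move=> i; rewrite inE => /negPf i0; rewrite binz0 i0 mulr0 scale0r.
rewrite (@fsum_seq _ _ _ [:: 0%N]) //; last first.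
  by move=> i; rewrite inE => /negPf i0; rewrite binz0 i0 mulr0 scale0r.
rewrite (@fsum_seq _ _ _ [:: 0; 1]%N) //; last first.
  by move=> [|[|i]] // _; rewrite binz1 scale0r.
rewrite !big_cons !big_nil !binz0 !binz1 /= !expr0 expr0z !mulr1 !scale1r !addr0.
rewrite !subr0 add0r (addrK 1 t) dY addrK => /(congr1 (fun k : D3 => k x)).
rewrite (linB (ev3 x)) (linD (ev3 x)) (linZ (ev3 x)) /=.
rewrite (conf_mode (j := 0) rho_wt2 (Y t f g) adm3) //.
have modeZ (M : comod_data V) h c (k : gdual (cm_gr M)) : admissible_comodule M ->
    weight_graded M h -> gdual_gr c k ->
    (md_mode (dual_module M) 1 (voa_conf (dual_voa V)) k : gdual (cm_gr M)) =
    (h + c%:R) *: k.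
  move=> adm wt kc; apply: gdual_fun_inj.
  rewrite (conf_mode (j := 0) rho_wt2 k adm) // (gdual_weight adm wt kc).
  by apply/funext => y; rewrite (linZ (@gdual_linl R M _ (cm_gr M) y)).
have /= -> := modeZ M1 h1 a f adm1 wt1 fa.
have /= -> := modeZ M2 h2 b g adm2 wt2 gb.
rewrite (linZ ((bY t).1 g)) (linZ ((bY t).2 f)) !(linZ (ev3 x)) /=.
rewrite (wt3 gx) (linZ (gdual_scalar (Y t f g))) /=.
move=> /eqP; rewrite subr_eq => /eqP ->; ring.
Qed.

Lemma tensor_gdual_ext (y z : tensor M1 M2) :
  (forall (f : D1) (g : D2), tform f g y = tform f g z) -> y = z.
Proof.
move=> yz; apply/eqP; rewrite -subr_eq0; apply/eqP.
apply: (tensor_separated (gdual_functional_space (cm_gr M1))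
  (gdual_separating (cm_grading adm1) fin1) (gdual_functional_space (cm_gr M2))
  (gdual_separating (cm_grading adm2) fin2)) => u f ug fg.
have [[lu _] [lf _]] := ((gdual_predP _ _).1 ug, (gdual_predP _ _).1 fg).
rewrite (linB (tform_scalar lu lf)).
by rewrite -(to_gdualK ug) -(to_gdualK fg) yz subrr.
Qed.

Definition transposes (W : R[i] -> M3 -> tensor M1 M2)
    (Y : R[i] -> D1 -> D2 -> D3) :=
  forall t f g, (Y t f g : M3 -> R[i]) = fun x => tform f g (W t x).

Section Transposes.
Variables (W : R[i] -> M3 -> tensor M1 M2) (Y : R[i] -> D1 -> D2 -> D3).
Hypothesis WY : transposes W Y.

Lemma transpose_derivative :
  (forall t x, (- t) *: W (t - 1) x = tmap (@cm_L R V M1 1) id (W t x)) <->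
  (forall t f g, Y t (md_mode (dual_module M1) 0 (voa_conf (dual_voa V)) f) g =
    (- t) *: Y (t - 1) f g).
Proof.
have Ef t (f : D1) (g : D2) x :
    Y t (md_mode (dual_module M1) 0 (voa_conf (dual_voa V)) f) g x =
    tform f g (tmap (@cm_L R V M1 1) id (W t x)).
  rewrite [LHS](congr1 (fun k => k x) (WY t _ g)).
  rewrite (conf_mode (j := 1) rho_wt2 f adm1) // tform_map //.
  - exact: cm_L_linear.
  - exact: gdual_scalar.
  - exact: gdual_scalar.
have Eg t (f : D1) (g : D2) x :
    ((- t) *: Y (t - 1) f g) x = tform f g ((- t) *: W (t - 1) x).
  rewrite (linZ (tform_scalar (gdual_scalar f) (gdual_scalar g))).
  by rewrite (linZ (@gdual_linl R M3 _ (cm_gr M3) x)) WY.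
split=> [dW t f g|dY t x].
  by apply: gdual_fun_inj; apply/funext => x; rewrite Ef Eg dW.
by apply: tensor_gdual_ext => f g; rewrite -Ef -Eg dY.
Qed.

Hypothesis lW : forall t, linear (W t).
Hypothesis bY : forall t, bilinear_for *:%R *:%R (Y t).
Hypothesis W_trunc : forall x, exists B : R, forall t : R[i],
  (complex.Re t < B)%R -> W t x = 0.
Hypothesis Y_trunc : forall f g, exists B : R, forall t : R[i],
  (B < complex.Re t)%R -> Y t f g = 0.

Lemma transpose_jacobi_identity :
  co_jacobi (cm_delta M1) (cm_delta M2) (cm_delta M3) W <->
  jacobi (md_mode (dual_module M1)) (md_mode (dual_module M2))
    (md_mode (dual_module M3)) Y.
Proof.
have DD1 := dual_module_dual adm1; have DD2 := dual_module_dual adm2.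
have DD3 := dual_module_dual adm3.
have Dtr (m : int) (x : M3) : eventually0 (fun i => cm_delta M3 (m - i%:Z) x).
  exact: (@trunc_eventually0 _ (fun k => cm_delta M3 k x) _ (cm_trunc adm3 x)).
have Wtr t x : eventually0 (fun i => W (t - i%:R) x).
  exact: (Re_trunc_eventually0 (W := W^~ x)).
have co := co_jacobi_at (D1 := fun k => cm_delta M1 k)
  (D2 := fun k => cm_delta M2 k) (D3 := fun k => cm_delta M3 k)
  (@delta_linear _ _ M1) (@delta_linear _ _ M2) lW Dtr Wtr
  (gdual_functional_space (voc_gr V))
  (gdual_separating (voc_grading V_voc) (voc_fin_dim V_voc))
  (gdual_functional_space (cm_gr M1))
  (gdual_separating (cm_grading adm1) fin1)
  (gdual_functional_space (cm_gr M2))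
  (gdual_separating (cm_grading adm2) fin2).
have mode_bil := dual_mode_bilinear DD3.
have tr : jacobi (md_mode (dual_module M1)) (md_mode (dual_module M2))
    (md_mode (dual_module M3)) Y <-> forall l m t (u : gdual (voc_gr V)) (f : D1)
      (g : D2) x, jacobi_at (fun k => cm_delta M1 k) (fun k => cm_delta M2 k)
        (fun k => cm_delta M3 k) W l m t u f g x.
  apply: (transpose_jacobi (evA := fun u : gdual (voc_gr V) => u)
    (do_lin DD3) (do_inj DD3) (do_mode DD1) (do_mode DD2) (do_mode DD3)).
  - exact: WY.
  - by move=> k u; exact: (lin0 ((mode_bil k).2 u)).
  - by move=> t g; exact: (lin0 ((bY t).1 g)).
  - by move=> t f; exact: (lin0 ((bY t).2 f)).
  - exact: (dual_trunc_eventually0 adm1 DD1).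
  - exact: (dual_trunc_eventually0 adm2 DD2).
  - by move=> t f g; exact: (Re_trunc_eventually0_high (W := fun t => Y t f g)).
split=> [/co jac|/tr jac].
  by apply/tr => l m t u f g x; apply: jac; exact: valP.
apply/co => l m t u f g x ug fg gg.
by rewrite -(to_gdualK ug) -(to_gdualK fg) -(to_gdualK gg); exact: jac.
Qed.

End Transposes.

(** Fusion rules do not change under duality: transposition is a linear
    bijection between the two spaces of operators.  That transposes stay within
    graded duals and tensor products rests on the degree relation. *)
Lemma cofusion_fusion :
  cofusion M1 M2 M3 = fusion (dual_module M1) (dual_module M2) (dual_module M3).
Proof.
have tlin (f : D1) (g : D2) := tform_scalar (gdual_scalar f) (gdual_scalar g).
apply: (dim_rel (rel := transposes)).
- by move=> t f g; apply/funext => x; rewrite (lin0 (tlin f g)).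
- move=> a W W' Y Y' WY WY' t f g; apply/funext => x.
  by rewrite (tlin f g) -[tform f g (W t x)](congr1 (@^~ x) (WY t f g))
    -[tform f g (W' t x)](congr1 (@^~ x) (WY' t f g)).
- move=> W Y Y' WY WY'; apply/funext => t; apply/funext => f; apply/funext => g.
  by apply: gdual_fun_inj; rewrite [LHS]WY [RHS]WY'.
- move=> W W' Y WY WY'; apply/funext => t; apply/funext => x.
  apply: tensor_gdual_ext => f g.
  by rewrite -[LHS](congr1 (@^~ x) (WY t f g)) -[RHS](congr1 (@^~ x) (WY' t f g)).
- move=> W Wco; have gW := cointertwining_graded Wco.
  have [lW Wtr dW jW] := Wco.
  pose Y t f g := to_gdual (cm_gr M3) (fun x => tform (f : D1) (g : D2) (W t x)).
  have WY : transposes W Y.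
    by move=> t f g; apply: to_gdualK; exact: (form_gdual adm1 adm2 gW).
  have bY t : bilinear_for *:%R *:%R (Y t).
    split=> [g|f] a u v; apply: gdual_fun_inj; apply/funext => x;
      rewrite (gdual_linl x) !WY; [exact: (gf_lin1 gW)|exact: (gf_lin2 gW)].
  have Ytr f g : exists B : R, forall t : R[i], (B < complex.Re t)%R -> Y t f g = 0.
    have [B BP] := form_trunc_high adm1 adm2 adm3 gW f g; exists B => t tB.
    by apply: gdual_fun_inj; rewrite WY; apply/funext => x; exact: BP.
  exists Y => //; split=> //; first exact/(transpose_derivative WY).
  exact/(transpose_jacobi_identity WY lW bY Wtr Ytr).
move=> Y Yin; have gY := intertwining_graded Yin.
have [bY Ytr dY jY] := Yin.
have rep t x := cid (form_represented adm1 adm2 adm3 gY fin1 fin2 t x).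
pose W t x := projT1 (rep t x).
have WE t x (f : D1) (g : D2) : tform f g (W t x) = (Y t f g : D3) x.
  exact: (projT2 (rep t x)).
have WY : transposes W Y by move=> t f g; apply/funext => x; rewrite WE.
have lW t : linear (W t).
  move=> a x y; apply: tensor_gdual_ext => f g.
  by rewrite (tlin f g) !WE; exact: (gdual_scalar (Y t f g)).
have Wtr x : exists B : R, forall t : R[i], (complex.Re t < B)%R -> W t x = 0.
  have [B BP] := form_trunc_low adm1 adm2 adm3 gY x; exists B => t tB.
  apply: tensor_gdual_ext => f g; rewrite (lin0 (tlin f g)) WE; exact: BP.
exists W => //; split=> //; first exact/(transpose_derivative WY).
exact/(transpose_jacobi_identity WY lW bY Wtr Ytr).
Qed.

End Fusion.

(** * Isomorphisms of comodules *)

Section ComoduleIso.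
Variables (R : realType) (V : voc_data R).

Lemma tmap_id_comp (F : fieldType) (U W W' W'' : lmodType F) (f : W -> W')
    (g : W' -> W'') (y : tensor U W) : linear f -> linear g ->
  tmap id g (tmap id f y) = tmap id (fun x => g (f x)) y.
Proof.
move=> lf lg; have lid : linear (@id U) by [].
have lgf := linear_comp lf lg.
move: y; apply: (tensor_ext (s := *:%R)).
- exact: linear_comp (tmap_linear lid lf) (tmap_linear lid lg).
- exact: tmap_linear.
by move=> v w; rewrite !tmap_tens.
Qed.

Lemma comodule_iso_sym (M N : comod_data V) : comodule_iso M N -> comodule_iso N M.
Proof.
move=> [f [[lf fD] [g fK gK]]]; exists g; split; last by exists f.
have lg : linear g by move=> a x y; rewrite -{1}(gK x) -{1}(gK y) -lf fK.
split=> // k x; rewrite -{2}(gK x) fD tmap_id_comp //.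
rewrite (_ : (fun x => g (f x)) = id); last by apply/funext.
have lid (U : lmodType R[i]) : linear (@id U) by [].
by move: (cm_delta M k (g x)); apply: (tensor_ext (s := *:%R)) => // [|v w];
  [exact: tmap_linear|rewrite tmap_tens].
Qed.

Lemma comodule_iso_trans (M N P : comod_data V) :
  comodule_iso M N -> comodule_iso N P -> comodule_iso M P.
Proof.
move=> [f [[lf fD] bf]] [g [[lg gD] bg]]; exists (fun x => g (f x)); split.
  by split=> [|k x]; [exact: linear_comp|rewrite gD fD tmap_id_comp].
exact: bij_comp bg bf.
Qed.

End ComoduleIso.

(** * Dual bases and the theorem *)

Section DualBases.
Variables (C : fieldType) (A K : lmodType C) (pair : A -> K -> C) (I : finType).
Variables (e' : I -> A) (e : I -> K).
Hypotheses (pl : forall a, scalar (pair^~ a)) (pr : forall f, scalar (pair f)).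
Hypothesis dual : dual_bases pair e' e.

Lemma basis_ext (U : lmodType C) (b : I -> U) (phi psi : U -> C) : is_basis b ->
  scalar phi -> scalar psi -> (forall i, phi (b i) = psi (b i)) -> phi =1 psi.
Proof.
move=> be lphi lpsi E x; have [c [-> _]] := be x.
rewrite (lin_sum lphi) (lin_sum lpsi); apply: eq_bigr => i _.
by rewrite (linZ lphi) (linZ lpsi) E.
Qed.

Lemma pair_coord (c : I -> C) j : pair (\sum_i c i *: e' i) (e j) = c j.
Proof.
have [_ _ d] := dual; rewrite (lin_sum (pl (e j))) (bigD1 j) //= big1.
  by rewrite addr0 (linZ (pl (e j))) /= d eqxx mulr1.
by move=> i ij; rewrite (linZ (pl (e j))) /= d (negPf ij) mulr0.
Qed.

(** Over dual bases, phi is represented by the vector whose coordinates are its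
    values on the basis e. *)
Lemma pair_perfect (phi : K -> C) : scalar phi ->
  exists! f : A, forall a, pair f a = phi a.
Proof.
move=> lphi; have [be be' _] := dual.
exists (\sum_i phi (e i) *: e' i); split=> [|f fE].
  by apply: (basis_ext be) => // j; rewrite pair_coord.
have [c [fc _]] := be' f; rewrite fc; apply: eq_bigr => i _.
by rewrite -fE fc pair_coord.
Qed.

End DualBases.

Lemma dual_bases_sym (C : fieldType) (A K : lmodType C) (pair : A -> K -> C)
    (I : finType) (e' : I -> A) (e : I -> K) :
  dual_bases pair e' e -> dual_bases (fun a f => pair f a) e e'.
Proof. by move=> [be be' d]; split=> // i j; rewrite d eq_sym. Qed.

Unset Implicit Arguments.

Theorem proposition6p1 (R : realType) (V : voc_data R)
  (V_voc : is_voc V) (V_simple : simple_voc V) (V_corational : corational V)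
  (rho_wt2 : forall s v, voc_gr V s v -> s != 2 -> voc_rho V v = 0)
  (homog_fin : forall M : comod_data V, comodule_obj M ->
     forall t, fin_dim (cm_gr M t))
  (fusion_fin : forall M1 M2 M3 : comod_data V,
     comodule_obj M1 -> comodule_obj M2 -> comodule_obj M3 ->
     fin_dim (cointertwining M1 M2 M3))
  (I : finType) (M : I -> comod_data V)
  (M_simple : forall i, admissible_comodule (M i) /\ simple_comodule (M i))
  (M_distinct : forall i j, comodule_iso (M i) (M j) -> i = j)
  (M_complete : forall N : comod_data V,
     admissible_comodule N -> simple_comodule N ->
     exists i, comodule_iso N (M i))
  (K Kop : lmodType R[i])
  (cls : comod_data V -> K) (clsop : mod_data (dual_voa V) -> Kop)
  (K_groth : grothendieck (@comodule_obj R V) (@comodule_iso R V)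
     (@comodule_ses R V) cls)
  (Kop_groth : grothendieck (@module_obj R (dual_voa V))
     (@module_iso R (dual_voa V)) (@module_ses R (dual_voa V)) clsop)
  (Delta : {linear K -> tensor K K}) (eps : {scalar K})
  (Delta_def : forall k, Delta (cls (M k)) =
     \sum_i \sum_j (cofusion (M i) (M j) (M k))%:R *:
       (cls (M i) ⊗ cls (M j)))
  (eps_def : forall k, eps (cls (M k)) =
     if `[< comodule_iso (M k) (voc_comodule V) >] then 1 else 0)
  (mul : {bilinear Kop -> Kop -> Kop})
  (mul_def : forall i j,
     mul (clsop (dual_module (M i))) (clsop (dual_module (M j))) =
     \sum_s (fusion (dual_module (M i)) (dual_module (M j))
               (dual_module (M s)))%:R *: clsop (dual_module (M s)))
  (pair : {bilinear Kop -> K -> R[i] | *%R & *%R})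
  (pair_dual : dual_bases pair (fun i => clsop (dual_module (M i)))
     (fun i => cls (M i))) :
  is_dual_algebra pair mul (clsop (voa_module (dual_voa V))) Delta eps /\
  is_dual_coalgebra pair mul (clsop (voa_module (dual_voa V))) Delta eps.
Proof.
have adm i := (M_simple i).1; have fin i : forall t, fin_dim (cm_gr (M i) t).
  apply: homog_fin; split; first exact: adm.
  exact/simple_fin_semisimple/(M_simple i).2.
have wt i : exists h, weight_graded (M i) h.
  exact: simple_weight_graded V_voc rho_wt2 _ (adm i) (fin i) (M_simple i).2.
have fus i j k : fusion (dual_module (M i)) (dual_module (M j)) (dual_module (M k))
    = cofusion (M i) (M j) (M k).
  have [h1 wt1] := wt i; have [h2 wt2] := wt j; have [h3 wt3] := wt k.
  exact/esym/(cofusion_fusion V_voc rho_wt2 (adm i) (adm j) (adm k) (fin i)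
    (fin j) wt1 wt2 wt3).
have admV := voc_comodule_admissible V_voc.
have [k0 V_k0] := M_complete _ admV V_simple.
have one_k0 : clsop (voa_module (dual_voa V)) = clsop (dual_module (M k0)).
  have finV t : fin_dim (cm_gr (voc_comodule V) t) by exact: (voc_fin_dim V_voc).
  have dualV := voa_module_dual V_voc; have dualM := dual_module_dual (adm k0).
  have [h hP] := wt k0; apply/esym/Kop_groth.1.1.
  - exact: (dual_obj V_voc (adm k0) dualM (fin k0) (M_simple k0).2).
  - exact: (dual_obj V_voc admV dualV finV V_simple).
  - exact: (dual_iso admV (adm k0) (voc_comodule_weight V_voc) hP dualV dualM).
have pl a : scalar (pair^~ a) by move=> c f g; exact: linearPl.
have pr f : scalar (pair f) by move=> c a b; exact: linearPr.
have [be be' d] := pair_dual.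
have counit : forall a, pair (clsop (voa_module (dual_voa V))) a = eps a.
  apply: (basis_ext be); [exact: pr|exact: linearP|move=> k].
  rewrite one_k0 d eps_def; case: asboolP => [kV|kV].
    by rewrite (M_distinct _ _ (comodule_iso_trans kV V_k0)) eqxx.
  by case: eqP => // k0k; case: kV; rewrite -k0k; exact: comodule_iso_sym.
have mulE : forall f g a, pair (mul f g) a = tform (pair f) (pair g) (Delta a).
  move=> f g a.
  have lD f' g' : scalar (fun a => tform (pair f') (pair g') (Delta a)).
    by move=> c x y; rewrite linearP (tform_scalar (pr f') (pr g')).
  move: f; apply: (basis_ext be' (phi := fun f => pair (mul f g) a)
      (psi := fun f => tform (pair f) (pair g) (Delta a))).
  - by move=> c x y; rewrite linearPl pl.
  - move=> c x y; rewrite /= -tform_linl; congr tform.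
    by apply/funext => z; rewrite pl.
  move=> i; move: g; apply: (basis_ext be' (phi := fun g => pair (mul _ g) a)
      (psi := fun g => tform (pair _) (pair g) (Delta a))).
  - by move=> c x y; rewrite linearPr pl.
  - move=> c x y; rewrite /= -tform_linr; congr tform.
    by apply/funext => z; rewrite pl.
  move=> j; move: a; apply: (basis_ext be) => // k.
  rewrite mul_def (pair_coord pl pair_dual (fun s => (fusion _ _ _)%:R)) fus.
  rewrite Delta_def; have lt := tform_scalar (pr (clsop (dual_module (M i))))
    (pr (clsop (dual_module (M j)))).
  rewrite (lin_sum lt) (bigD1 i) //= (lin_sum lt) (bigD1 j) //=.
  rewrite (linZ lt) /= tform_tens // !d !eqxx !mulr1 !big1 ?addr0 //.
    move=> i' ii'; rewrite (lin_sum lt) big1 // => j' _.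
    by rewrite (linZ lt) /= tform_tens // !d [i == i']eq_sym (negPf ii') mul0r mulr0.
  move=> j' jj'.
  by rewrite (linZ lt) /= tform_tens // !d [j == j']eq_sym (negPf jj') !mulr0.
split; split=> //.
- by move=> phi; apply: (pair_perfect pl pr pair_dual); exact: linearP.
- move=> phi; apply: (pair_perfect pr pl (dual_bases_sym pair_dual)).
  exact: linearP.
Qed.
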